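(* Let $f:\mathbb{R}^n\to\mathbb{R}$ be continuously differentiable, let $\varphi:\mathbb{R}^n\to(-\infty,\infty]$ be convex, lower semicontinuous and proper, and put $\psi=f+\varphi$. Assume that $\nabla f$ is Lipschitz continuous on $\mathrm{dom}(\varphi)$ with modulus $L$, and that $\psi$ is bounded from below on $\mathrm{dom}(\partial\varphi)$. Let $\{z_k\}$ be generated by the Algorithm described in the context, with $x_k=\mathrm{prox}_{\lambda\varphi}(z_k)$ and with $$\nu_k=\min\{\nu,\;a_k^2\,\|\mathrm{prox}_{\lambda\varphi}(z_k+s_k(\alpha_k))-x_k\|^{2p}\},\qquad a_k=(k\ln^2(k+1))^p,\quad p>0 .$$ Suppose $\bar z$ is an accumulation point of $\{z_k\}$ such that $\psi$ has the Kurdyka–Łojasiewicz property at $\bar x=\mathrm{prox}_{\lambda\varphi}(\bar z)$. Then $\sum_{k=0}^\infty\|x_{k+1}-x_k\|<\infty$ and the whole sequence $\{z_k\}$ converges to $\bar z$, with $\bar x=\mathrm{prox}_{\lambda\varphi}(\bar z)\in\mathrm{crit}(\psi)$.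
   Context: Notation. $\lambda>0$ is fixed; $\mathrm{prox}_{\lambda\varphi}(z)=\mathrm{argmin}_{y}\,\varphi(y)+\frac1{2\lambda}\|z-y\|^2$; $F^\lambda_{\mathrm{nor}}(z)=\nabla f(\mathrm{prox}_{\lambda\varphi}(z))+\lambda^{-1}(z-\mathrm{prox}_{\lambda\varphi}(z))$ (normal map); $\chi(z)=\|F^\lambda_{\mathrm{nor}}(z)\|$; merit function $H(\tau,z)=\psi(\mathrm{prox}_{\lambda\varphi}(z))+\frac{\tau\lambda}{2}\|F^\lambda_{\mathrm{nor}}(z)\|^2$. $\partial\psi(x)=\nabla f(x)+\partial\varphi(x)$ and $\mathrm{crit}(\psi)=\{x:0\in\partial\psi(x)\}$. $\partial\,\mathrm{prox}_{\lambda\varphi}(z)$ is Clarke's generalized Jacobian. KL property. For $\eta'\in(0,\infty]$, $\mathfrak S_{\eta'}$ is the class of continuous concave functions $\varrho:[0,\eta')\to[0,\infty)$ with $\varrho\in C^1((0,\eta'))$, $\varrho(0)=0$, $\varrho'(t)>0$ for all $t\in(0,\eta')$. $\psi$ has the Kurdyka–Łojasiewicz (KL) property at $\bar x\in\mathrm{dom}(\partial\varphi)$ if there are $\eta'\in(0,\infty]$, a neighborhood $U$ of $\bar x$ and $\varrho\in\mathfrak S_{\eta'}$ such that $\varrho'(\psi(x)-\psi(\bar x))\cdot\mathrm{dist}(0,\partial\psi(x))\ge1$ for all $x\in U$ with $0<\psi(x)-\psi(\bar x)<\eta'$. CG method. For a symmetric matrix $S\in\mathbb{R}^{n\times n}$,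 $g\in\mathbb{R}^n$, $\epsilon\ge0$, CG$(S,g,\epsilon)$ for the system $S\tilde q=-g$ is: set $q_0=0$, $r_0=g$, $p_0=-g$. If $\|r_0\|\le\epsilon$ return $q_0$. For $i=0,1,\dots,n-1$: if $\langle p_i,Sp_i\rangle\le 0$, return $p_0$ when $i=0$ and $q_i$ when $i\ne0$; otherwise set $\alpha_i=\|r_i\|^2/\langle p_i,Sp_i\rangle$, $q_{i+1}=q_i+\alpha_ip_i$, $r_{i+1}=r_i+\alpha_iSp_i$; if $\|r_{i+1}\|\le\epsilon$ return $q_{i+1}$; otherwise set $\beta_{i+1}=\|r_{i+1}\|^2/\|r_i\|^2$, $p_{i+1}=-r_{i+1}+\beta_{i+1}p_i$. Algorithm. Parameters: $z_0\in\mathbb{R}^n$, symmetric $B_0$, $\bar L,\lambda,\tau_{-1}>0$, $\sigma,\rho,\gamma,\nu\in(0,1)$, $q,\eta>0$, tolerances $\epsilon_k\ge0$. For $k=0,1,\dots$, while $F^\lambda_{\mathrm{nor}}(z_k)\neq0$ (otherwise terminate): (1) Choose $D_k\in\partial\,\mathrm{prox}_{\lambda\varphi}(z_k)$ and set $M_k=B_kD_k+\frac1\lambda(I-D_k)$. (2) Let $q_k$ be the output of CG$(D_kM_k,\,D_kF^\lambda_{\mathrm{nor}}(z_k),\,\epsilon_k)$; set $d_k=-F^\lambda_{\mathrm{nor}}(z_k)$ and $e_k=q_k/\lambda-M_kq_k$. (3) With $b_k=(k\ln^2(k+1))^q$ and $\eta_k=\min\{b_k\chi(z_k)^q,\eta\}$,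 test whether $\eta_k\|e_k\|\le\chi(z_k)$. If the test holds, set $s_k(\alpha)=\alpha\lambda(d_k+\alpha e_k)$ (second-order case); otherwise set $s_k(\alpha)=\alpha\lambda d_k$ (first-order case). (4) Linesearch: for $t=0,1,2,\dots$ put $\alpha=\rho^t$, $x_k=\mathrm{prox}_{\lambda\varphi}(z_k)$, $p_\alpha=\mathrm{prox}_{\lambda\varphi}(z_k+s_k(\alpha))$, $U_\alpha=f(p_\alpha)-f(x_k)-\langle\nabla f(x_k),p_\alpha-x_k\rangle$, $V_\alpha=\|p_\alpha-x_k\|$, $W_\alpha=\|\nabla f(p_\alpha)-\nabla f(x_k)\|$; set $L_k^{(t)}=\max\{2U_\alpha/V_\alpha^2,\,W_\alpha/V_\alpha\}$ if $V_\alpha\ne0$ and $L_k^{(t)}=\bar L$ otherwise; set $\tau_k^{(t)}=\min\{\frac{2\gamma(1-\nu_k)}{(L_k^{(t)})^2\lambda^2+2},\tau_{k-1}\}$. Stop at the first $t$ for which $$H(\tau_k^{(t)},z_k+s_k(\alpha))-H(\tau_k^{(t)},z_k)\le-\frac{\sigma\lambda\tau_k^{(t)}\alpha}{2}\chi(z_k)^2-\frac{\nu_k}{\lambda\alpha}\|p_\alpha-x_k\|^2,$$ and then set $\alpha_k=\alpha$, $\tau_k=\tau_k^{(t)}$, $L_k=L_k^{(t)}$. During the linesearch, $\nu_k$ is evaluated by its formula with the trial step, i.e. $\nu_k=\min\{\nu,a_k^2\|p_\alpha-x_k\|^{2p}\}$, so that upon acceptance it equals the formula with $\alpha=\alpha_k$.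 (5) Set $z_{k+1}=z_k+s_k(\alpha_k)$ and choose a symmetric matrix $B_{k+1}$ (an approximation of $\nabla^2 f(\mathrm{prox}_{\lambda\varphi}(z_{k+1}))$; no accuracy is required unless stated). If the Algorithm terminates at some $z_{K_0}$, the sequence is continued constantly, $z_k=z_{K_0}$ for $k\ge K_0$. *)

(* Defs.v *)
From HB Require Import structures.
From mathcomp Require Import all_boot all_order all_algebra.
From mathcomp Require Import all_classical all_reals all_analysis.
Set Implicit Arguments.
Unset Strict Implicit.
Unset Printing Implicit Defensive.
Import Order.TTheory GRing.Theory Num.Theory.
Import numFieldNormedType.Exports.

Local Open Scope classical_set_scope.
Local Open Scope ring_scope.

(* Vectors of R^n are columns.  The library norm on 'cV[R]_n is the sup norm: it
   is used only for topology and differentiability; all quantitative statements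
   use the Euclidean norm [enorm]. *)

Section Euclidean.
Context {R : realType} {n : nat}.
Implicit Types u v : 'cV[R]_n.

Definition dotp u v : R := \sum_i u i 0 * v i 0.
Definition enorm u : R := Num.sqrt (dotp u u).

Definition gradient (f : 'cV[R]_n -> R) (x : 'cV[R]_n) : 'cV[R]_n :=
  \col_i 'D_(delta_mx i 0) f x.

Definition continuously_differentiable (f : 'cV[R]_n -> R) : Prop :=
  (forall x, differentiable f x) /\ continuous (gradient f).

Definition jacobian_col (F : 'cV[R]_n -> 'cV[R]_n) (x : 'cV[R]_n) : 'M[R]_n :=
  \matrix_(i, j) ('D_(delta_mx j 0) F x) i 0.

Definition conv_hull (A : set 'M[R]_n) : set 'M[R]_n :=
  [set D | exists m (w : 'I_m -> R) (J : 'I_m -> 'M[R]_n),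
    [/\ forall i, 0 <= w i, \sum_i w i = 1, forall i, A (J i)
      & D = \sum_i w i *: J i]].

Definition bouligand (F : 'cV[R]_n -> 'cV[R]_n) (x : 'cV[R]_n) : set 'M[R]_n :=
  [set J | exists u : nat -> 'cV[R]_n,
    [/\ forall j, differentiable F (u j), u @ \oo --> x
      & (fun j => jacobian_col F (u j)) @ \oo --> J]].

Definition clarke_jacobian (F : 'cV[R]_n -> 'cV[R]_n) (x : 'cV[R]_n) :
  set 'M[R]_n := conv_hull (bouligand F x).

End Euclidean.

Section ConvexAnalysis.
Context {R : realType} {n : nat}.
Implicit Types (phi : 'cV[R]_n -> \bar R) (f : 'cV[R]_n -> R) (x y z : 'cV[R]_n).
Local Open Scope ereal_scope.

Definition edom phi : set 'cV[R]_n := [set x | phi x < +oo].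

Definition eproper phi : Prop := (forall x, -oo < phi x) /\ edom phi !=set0.

(* the library's [convex_function] is restricted to real-valued functions *)
Definition econvex phi : Prop := forall x y (t : R), (0 <= t <= 1)%R ->
  phi (t *: x + (1 - t) *: y)%R <= t%:E * phi x + (1 - t)%:E * phi y.

Definition subdiff phi x : set 'cV[R]_n :=
  [set g | edom phi x /\ forall y, phi x + (dotp g (y - x)%R)%:E <= phi y].

Definition dom_subdiff phi : set 'cV[R]_n := [set x | subdiff phi x !=set0].

Definition argmin (h : 'cV[R]_n -> \bar R) : set 'cV[R]_n :=
  [set x | forall y, h x <= h y].

Definition prox (lam : R) phi z : 'cV[R]_n :=
  get (argmin (fun y => phi y + ((2 * lam)^-1 * enorm (z - y) ^+ 2)%:E)).

Definition psi f phi x : \bar R := (f x)%:E + phi x.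

Definition subdiff_psi f phi x : set 'cV[R]_n :=
  [set (gradient f x + g)%R | g in subdiff phi x].

Definition crit f phi : set 'cV[R]_n := [set x | subdiff_psi f phi x 0%R].

(* equals +oo when A is empty *)
Definition dist0 (A : set 'cV[R]_n) : \bar R :=
  ereal_inf [set (enorm v)%:E | v in A].

Definition desingularizing (eta : \bar R) (h : R -> R) : Prop :=
  let D := [set t : R | (0 <= t)%R /\ t%:E < eta] in
  [/\ {within D, continuous h},
      @convex_function R R^o D (fun t => - h t)%R,
      forall t, D t -> (0 <= h t)%R,
      h 0%R = 0%R
    & forall t : R, (0 < t)%R -> t%:E < eta ->
        [/\ derivable h t 1%R, {for t, continuous (derive1 h)}
          & (0 < derive1 h t)%R]].

Definition KL_property f phi (xbar : 'cV[R]_n) : Prop :=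
  dom_subdiff phi xbar /\
  exists (eta : \bar R) (h : R -> R),
    [/\ 0 < eta, desingularizing eta h
      & \forall x \near xbar,
          0 < psi f phi x - psi f phi xbar < eta ->
          1 <= (derive1 h (fine (psi f phi x - psi f phi xbar)))%:E
               * dist0 (subdiff_psi f phi x)].

End ConvexAnalysis.

Section ConjugateGradient.
Context {R : realType} {n : nat}.
Implicit Types (S : 'M[R]_n) (g q r p : 'cV[R]_n).

(* [m] is the number of remaining passes, [first] holds iff i = 0; [None] means
   that all passes were used up without reaching a return instruction. *)
Fixpoint cg_loop S (eps : R) (m : nat) (first : bool) q r p :
    option 'cV[R]_n :=
  if m is m'.+1 then
    let c := dotp p (S *m p) in
    if c <= 0 then Some (if first then p else q)
    else
      let a := enorm r ^+ 2 / c in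
      let q' := q + a *: p in
      let r' := r + a *: (S *m p) in
      if enorm r' <= eps then Some q'
      else
        let b := enorm r' ^+ 2 / enorm r ^+ 2 in
        cg_loop S eps m' false q' r' (- r' + b *: p)
  else None.

Definition cg S g (eps : R) : option 'cV[R]_n :=
  if enorm g <= eps then Some 0 else cg_loop S eps n true 0 g (- g).

End ConjugateGradient.

Record params (R : realType) := Params {
  Lbar : R;
  tau_init : R; (* tau_(-1) *)
  sigma : R;
  rho : R;
  gamma : R;
  nu : R;
  expq : R;     (* exponent q in b_k *)
  expp : R;     (* exponent p in a_k and nu_k *)
  eta : R
}.

Definition admissible (R : realType) (P : params R) : Prop :=
  [/\ 0 < Lbar P, 0 < tau_init P,
      [/\ 0 < sigma P < 1, 0 < rho P < 1, 0 < gamma P < 1 & 0 < nu P < 1]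
    & [/\ 0 < expq P, 0 < expp P & 0 < eta P]].

Section Algorithm.
Context {R : realType} {n : nat}.
Variables (f : 'cV[R]_n -> R) (phi : 'cV[R]_n -> \bar R) (lam : R).
Variable P : params R.
Implicit Types (k : nat) (x z d e s y : 'cV[R]_n) (B D : 'M[R]_n).

Local Notation prx := (prox lam phi).
Local Notation grad := (gradient f).

Definition Fnor z : 'cV[R]_n := grad (prx z) + lam^-1 *: (z - prx z).
Definition chi z : R := enorm (Fnor z).

Definition merit (tau : R) z : \bar R :=
  (psi f phi (prx z) + (tau * lam / 2 * enorm (Fnor z) ^+ 2)%:E)%E.

Definition log_weight k : R := k%:R * ln (k.+1)%:R ^+ 2.
Definition a_seq k : R := log_weight k `^ expp P.
Definition b_seq k : R := log_weight k `^ expq P.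

Definition second_order_test k z e : bool :=
  Num.min (b_seq k * chi z `^ expq P) (eta P) * enorm e <= chi z.

Definition trial_shift (second : bool) d e (alpha : R) : 'cV[R]_n :=
  if second then (alpha * lam) *: (d + alpha *: e) else (alpha * lam) *: d.

(* below, x = prox(z_k) and y = prox(z_k + s_k(alpha)) *)
Definition trial_L x y : R :=
  let U := f y - f x - dotp (grad x) (y - x) in
  let V := enorm (y - x) in
  let W := enorm (grad y - grad x) in
  if V != 0 then Num.max (2 * U / V ^+ 2) (W / V) else Lbar P.

Definition trial_nu k x y : R :=
  Num.min (nu P) (a_seq k ^+ 2 * enorm (y - x) `^ (2 * expp P)).

Definition trial_tau k (tau_prev : R) x y : R :=
  Num.min (2 * gamma P * (1 - trial_nu k x y)
             / (trial_L x y ^+ 2 * lam ^+ 2 + 2)) tau_prev.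

Definition ls_accept k (tau_prev : R) z s (alpha : R) : Prop :=
  let x := prx z in
  let y := prx (z + s) in
  let tau := trial_tau k tau_prev x y in
  (merit tau (z + s) - merit tau z <=
     (- (sigma P * lam * tau * alpha / 2) * chi z ^+ 2
      - trial_nu k x y / (lam * alpha) * enorm (y - x) ^+ 2)%:E)%E.

Definition iteration k B (eps : R) (tau_prev : R) z (tau : R) z' : Prop :=
  exists (D : 'M[R]_n) (q : 'cV[R]_n) (t : nat),
    let M := B *m D + lam^-1 *: (1%:M - D) in
    let d := - Fnor z in
    let e := lam^-1 *: q - M *m q in
    let s := trial_shift (second_order_test k z e) d e in
    [/\ clarke_jacobian prx z D,
        cg (D *m M) (D *m Fnor z) eps = Some q,
        ls_accept k tau_prev z (s (rho P ^+ t)) (rho P ^+ t)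
        /\ (forall j, (j < t)%N ->
              ~ ls_accept k tau_prev z (s (rho P ^+ j)) (rho P ^+ j)),
        tau = trial_tau k tau_prev (prx z) (prx (z + s (rho P ^+ t)))
      & z' = z + s (rho P ^+ t)].

(* The sequence [tau] is shifted by one: tau 0 is tau_(-1), tau k.+1 is tau_k. *)
Definition algorithm_sequence (B : nat -> 'M[R]_n) (eps : nat -> R)
    (z : nat -> 'cV[R]_n) : Prop :=
  exists tau : nat -> R, tau 0%N = tau_init P /\
    forall k, if Fnor (z k) == 0 then z k.+1 = z k
              else (B k)^T = B k /\
                   iteration k (B k) (eps k) (tau k) (z k) (tau k.+1) (z k.+1).

End Algorithm.

(* Main.v *)
Require Import Defs.
From mathcomp Require Import all_boot all_order all_algebra.
From mathcomp Require Import all_classical all_reals all_analysis.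
From mathcomp Require Import ring lra.
Import Order.TTheory GRing.Theory Num.Theory.
Import numFieldNormedType.Exports.
Local Open Scope classical_set_scope.
Local Open Scope ring_scope.

(** Write [x_k = prox (z_k)], [chi_k = |F (z_k)|], [V_k = |x_(k+1) - x_k|], and
    let [excess_k] be the merit value [H (tau_k, z_k)] minus the objective at
    [xbar], where [tau_k] stands for the value used before the [k]-th linesearch.
    Acceptance of a step, together with the monotonicity of [tau], gives

      excess_k - excess_(k+1)
        >= sigma lam tau alpha_k / 2 * chi_k ^ 2 + nu_k / (lam alpha_k) * V_k ^ 2.

    The step size enters the two terms reciprocally, so when [nu_k = nu] the
    right-hand side dominates a multiple of [chi_k * V_k] whatever [alpha_k] is
    ([step_le_potential]). The Kurdyka-Lojasiewicz inequality bounds [1 / chi_k]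
    by the slope of a concave function of [excess_k]
    ([merit_potential_decrease]), and concavity turns the two bounds into
    [V_k <= C (Phi_k - Phi_(k+1))]. When [nu_k < nu], the definition of [nu_k]
    says that [V_k < 1 / (k ln^2 (k+1))], which is at most a difference of
    consecutive terms of [2 / ln k]. In both cases [V_k] is bounded by a
    decrement of one nonnegative null sequence. This holds as long as [x_k] stays
    in the neighbourhood of [xbar] where the KL inequality is available; a
    late iterate close enough to [xbar] has too short a path ahead of it to leave
    that neighbourhood ([path_eventually_controlled]). Hence the path has finite
    length and [x_k] converges to [xbar].

    The argument needs [excess_k] to tend to [0], hence [F (zbar) = 0]
    ([limit_stationary]). Otherwise [chi] is bounded below near [zbar], where
    also the second-order directions are bounded; the quadratic remainder of the
    merit function along a trial step is then dominated for all step sizes below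
    a fixed bound ([small_step_accepted]), so the accepted step sizes are bounded
    below and the merit value drops by a fixed amount at each of the infinitely
    many visits near [zbar], which is impossible.

    Once [x_k] converges, the subgradient inequality at [xbar] shows that the
    merit excess eventually bounds [chi_k ^ 2], so [chi_k] tends to [0] and
    [z_k = x_k - lam * gradient f x_k + lam * F (z_k)] converges as well. *)

(** * Euclidean geometry of column vectors *)

Section EuclideanTheory.
Context {R : realType} {n : nat}.
Implicit Types (u v w : 'cV[R]_n) (a : R).

Lemma dotpC u v : dotp u v = dotp v u.
Proof. by apply: eq_bigr => i _; rewrite mulrC. Qed.

Lemma dotpDl u v w : dotp (u + v) w = dotp u w + dotp v w.
Proof. by rewrite -big_split; apply: eq_bigr => i _; rewrite mxE mulrDl. Qed.

Lemma dotpZl a u w : dotp (a *: u) w = a * dotp u w.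
Proof. by rewrite /dotp big_distrr; apply: eq_bigr => i _; rewrite mxE /= mulrA.
Qed.

Lemma dotpNl u w : dotp (- u) w = - dotp u w.
Proof. by rewrite -scaleN1r dotpZl mulN1r. Qed.

Lemma dotp0l u : dotp 0 u = 0.
Proof. by rewrite -(scale0r 0) dotpZl mul0r. Qed.

Lemma dotpDr u v w : dotp w (u + v) = dotp w u + dotp w v.
Proof. by rewrite dotpC dotpDl !(dotpC w). Qed.

Lemma dotpZr a u w : dotp w (a *: u) = a * dotp w u.
Proof. by rewrite dotpC dotpZl dotpC. Qed.

Lemma dotpNr u w : dotp w (- u) = - dotp w u.
Proof. by rewrite dotpC dotpNl dotpC. Qed.

Definition dotpE := (dotpDl, dotpDr, dotpZl, dotpZr, dotpNl, dotpNr).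

Lemma dotp_ge0 u : 0 <= dotp u u.
Proof. by apply: sumr_ge0 => i _; rewrite -expr2 sqr_ge0. Qed.

Lemma enorm_ge0 u : 0 <= enorm u.
Proof. exact: sqrtr_ge0. Qed.

Lemma enorm_sqr u : enorm u ^+ 2 = dotp u u.
Proof. by rewrite sqr_sqrtr // dotp_ge0. Qed.

Lemma dotp_eq0 u : dotp u u = 0 -> u = 0.
Proof.
move=> /eqP; rewrite psumr_eq0 => [/allP u0|i _]; last by rewrite -expr2 sqr_ge0.
apply/colP => i; rewrite mxE.
by have := u0 i (mem_index_enum i); rewrite mulf_eq0 orbb => /eqP.
Qed.

Lemma enorm_eq0 u : (enorm u == 0) = (u == 0).
Proof.
apply/eqP/eqP => [u0|->].
  by apply: dotp_eq0; rewrite -enorm_sqr u0 expr0n.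
by rewrite /enorm /dotp big1 ?sqrtr0 // => i _; rewrite mxE mul0r.
Qed.

Lemma enorm0 : enorm (0 : 'cV[R]_n) = 0.
Proof. by apply/eqP; rewrite enorm_eq0. Qed.

Lemma enormZ a u : enorm (a *: u) = `|a| * enorm u.
Proof.
by rewrite /enorm dotpZl dotpZr mulrA -expr2 sqrtrM ?sqr_ge0 // sqrtr_sqr.
Qed.

Lemma enormN u : enorm (- u) = enorm u.
Proof. by rewrite -scaleN1r enormZ normrN1 mul1r. Qed.

Lemma enormB u v : enorm (u - v) = enorm (v - u).
Proof. by rewrite -enormN opprB. Qed.

(** Cauchy-Schwarz: the squared length of [|v|^2 u - <u,v> v] is nonnegative. *)
Lemma dotp_le u v : dotp u v <= enorm u * enorm v.
Proof.
have [->|v0] := eqVneq v 0.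
  by rewrite enorm0 mulr0 -[0 in X in X <= _](scale0r 0) dotpZr mul0r.
have vv : 0 < dotp v v.
  by rewrite lt_def dotp_ge0 andbT; apply: contra v0 => /eqP/dotp_eq0 ->.
have := dotp_ge0 (dotp v v *: u - dotp u v *: v); rewrite !dotpE (dotpC v u).
move=> uv0.
have {uv0} : 0 <= dotp v v * (dotp u u * dotp v v - dotp u v ^+ 2) by lra.
rewrite pmulr_rge0 // subr_ge0 => uv.
have [/ltW uv0|uv0] := ltP (dotp u v) 0.
  by apply: (le_trans uv0); rewrite mulr_ge0 ?enorm_ge0.
rewrite -(@ler_pXn2r _ 2) // ?nnegrE ?mulr_ge0 ?enorm_ge0 //.
by rewrite exprMn !enorm_sqr.
Qed.

Lemma dotp_ge u v : - (enorm u * enorm v) <= dotp u v.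
Proof. by rewrite lerNl -dotpNl -(enormN u) dotp_le. Qed.

Lemma enormD u v : enorm (u + v) <= enorm u + enorm v.
Proof.
rewrite -(@ler_pXn2r _ 2) // ?nnegrE ?addr_ge0 ?enorm_ge0 //.
rewrite enorm_sqr sqrrD !enorm_sqr !dotpE (dotpC v u).
by have := dotp_le u v; lra.
Qed.

Lemma enorm_distD w u v : enorm (u - v) <= enorm (u - w) + enorm (w - v).
Proof. by rewrite -[u - v](subrKA w) enormD. Qed.

Lemma normr_le_enorm u : `|u| <= enorm u.
Proof.
rewrite [leLHS]mx_normrE; apply/bigmax_leP; split=> [|[i j] _] /=.
  exact: enorm_ge0.
rewrite (ord1 j) -sqrtr_sqr ler_wsqrtr // expr2 /dotp (bigD1 i) //= lerDl.
by apply: sumr_ge0 => k _; rewrite -expr2 sqr_ge0.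
Qed.

Lemma enorm_le_normr u : enorm u <= n%:R * `|u|.
Proof.
have entry i : `|u i 0| <= `|u|.
  by rewrite [leRHS]mx_normrE (le_bigmax _ (fun ij => `|u ij.1 ij.2|) (i, 0)).
rewrite -(@ler_pXn2r _ 2) // ?nnegrE ?mulr_ge0 ?enorm_ge0 //.
rewrite enorm_sqr exprMn.
apply: (@le_trans _ _ (\sum_(i < n) `|u| ^+ 2)).
  apply: ler_sum => i _; rewrite -expr2 -real_normK ?num_real //.
  by rewrite ler_pXn2r ?nnegrE.
rewrite sumr_const card_ord -[_ *+ n]mulr_natl ler_wpM2r ?sqr_ge0 //.
by rewrite -natrX ler_nat; case: (n) => // m; rewrite expnS leq_pmulr.
Qed.

(** The topology of ['cV_n] comes from the sup norm, which is equivalent to the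
    Euclidean norm. *)
Lemma nbhs_enormP (x : 'cV[R]_n) (A : set 'cV[R]_n) :
  nbhs x A <-> exists2 r : R, 0 < r & forall y, enorm (y - x) < r -> A y.
Proof.
split=> [/nbhs_ballP[r /= r0 rA]|[r r0 rA]].
  exists r => // y yx; apply: rA; rewrite -ball_normE /=.
  by rewrite -opprB normrN (le_lt_trans (normr_le_enorm _)).
apply/nbhs_ballP; exists (r / n.+1%:R) => /=; first by rewrite divr_gt0.
move=> y; rewrite -ball_normE /= -opprB normrN ltr_pdivlMr // => yx; apply: rA.
apply: (le_lt_trans (enorm_le_normr _)); apply: le_lt_trans yx.
by rewrite mulrC ler_wpM2l // ler_nat.
Qed.

Lemma cvg_enormP (u : nat -> 'cV[R]_n) (x : 'cV[R]_n) :
  u @ \oo --> x <->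
  forall r : R, 0 < r -> exists N, forall k, (N <= k)%N -> enorm (u k - x) < r.
Proof.
split=> [ux r r0|ux A /nbhs_enormP[r r0 rA]].
  have : nbhs x [set y | enorm (y - x) < r] by apply/nbhs_enormP; exists r.
  by move=> /ux[N _ uN]; exists N => k Nk; exact: uN.
have [N uN] := ux _ r0; exists N => // k /= Nk; apply: rA; exact: uN.
Qed.

Lemma cluster_enormP (u : nat -> 'cV[R]_n) (x : 'cV[R]_n) :
  cluster (u @ \oo) x ->
  forall (r : R) N, 0 < r -> exists2 k, (N <= k)%N & enorm (u k - x) < r.
Proof.
move=> ux r N r0.
have [||y [[k /= Nk <-] kr]] := ux (u @` [set k | (N <= k)%N])
    [set y | enorm (y - x) < r].
- by exists N => // k /= Nk; exists k.
- by apply/nbhs_enormP; exists r.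
- by exists k.
Qed.

Lemma cauchy_enorm_cvg (u : nat -> 'cV[R]_n) :
  (forall r : R, 0 < r -> exists N, forall i j, (N <= i)%N -> (N <= j)%N ->
     enorm (u i - u j) < r) ->
  exists x : 'cV[R]_n, u @ \oo --> x.
Proof.
move=> uC; suff : cvg (u @ \oo) by move=> ?; exists (lim (u @ \oo)).
apply/cauchy_cvgP/cauchy_ballP => r r0; have [N uN] := uC _ r0.
have FN : (u @ \oo) (u @` [set k | (N <= k)%N]).
  by exists N => // k /= Nk; exists k.
exists (u @` [set k | (N <= k)%N], u @` [set k | (N <= k)%N]) => //.
move=> [a b] /= [[i Ni <-] [j Nj <-]].
by rewrite -ball_normE /= (le_lt_trans (normr_le_enorm _)) // uN.
Qed.

End EuclideanTheory.

(** * The proximal operator, and first-order expansions of smooth functions *)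

Lemma ge0_of_small_perturbation {R : realType} (A B : R) :
  (forall t : R, 0 < t <= 1 -> 0 <= A + t * B) -> 0 <= A.
Proof.
move=> AB; rewrite leNgt; apply/negP => A0.
have B0 : 0 < `|B| + 1 by have := normr_ge0 B; lra.
pose t := Num.min 1 (- A / (2 * (`|B| + 1))).
have t0 : 0 < t by rewrite lt_min ltr01 divr_gt0 //; lra.
have := AB t; rewrite t0 ge_min lexx => /(_ isT).
have : t * B <= t * `|B| by rewrite ler_pM2l // ler_norm.
have : t * (2 * (`|B| + 1)) <= - A.
  by rewrite -ler_pdivlMr ?mulr_gt0 // ge_min lexx orbT.
by lra.
Qed.

Lemma sqr_ge_sub {R : realType} (T t r : R) :
  0 <= T -> 0 <= t -> T - t <= r -> T ^+ 2 - 2 * T * r <= t ^+ 2.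
Proof.
move=> T0 t0 Ttr; have : 0 <= T * (r - (T - t)) by rewrite mulr_ge0 //; lra.
by have := sqr_ge0 (T - t); lra.
Qed.

Section Prox.
Context {R : realType} {n : nat} (phi : 'cV[R]_n -> \bar R) (lam : R).
Context (phi_convex : econvex phi) (phi_lsc : lower_semicontinuous phi).
Context (phi_proper : eproper phi) (lam_gt0 : 0 < lam).
Context (phi_subdiff : dom_subdiff phi !=set0).

Local Notation phir x := (fine (phi x)).

Lemma edom_fin x : edom phi x -> phi x = (phir x)%:E.
Proof.
by move=> x_dom; rewrite fineK // fin_numElt x_dom (proj1 phi_proper).
Qed.

Lemma subdiff_le x g y :
  subdiff phi x g -> edom phi y -> phir x + dotp g (y - x) <= phir y.
Proof.
move=> [x_dom gx] y_dom; have := gx y.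
by rewrite (edom_fin _ x_dom) (edom_fin _ y_dom) -EFinD lee_fin.
Qed.

Lemma econvex_fin x y t : edom phi x -> edom phi y -> 0 <= t <= 1 ->
  edom phi (t *: x + (1 - t) *: y) /\
  phir (t *: x + (1 - t) *: y) <= t * phir x + (1 - t) * phir y.
Proof.
move=> x_dom y_dom t01; have := phi_convex x y t t01.
rewrite (edom_fin _ x_dom) (edom_fin _ y_dom) -!EFinM -EFinD => xy.
have w_dom : edom phi (t *: x + (1 - t) *: y) by apply: le_lt_trans xy (ltry _).
by split=> //; move: xy; rewrite (edom_fin _ w_dom) lee_fin.
Qed.

Local Notation obj z y := (phir y + (2 * lam)^-1 * enorm (z - y) ^+ 2).

(** A subgradient gives an affine minorant of [phi], and the quadratic term
    outgrows every affine function. *)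
Lemma prox_objective_bounded z :
  exists m : R, forall y, edom phi y -> m <= obj z y.
Proof.
have [x0 [g gx0]] := phi_subdiff.
exists (phir x0 + dotp g (z - x0) - lam / 2 * enorm g ^+ 2) => y y_dom.
have := subdiff_le _ _ _ gx0 y_dom.
have -> : y - x0 = - (z - y) + (z - x0) by rewrite opprB addrA subrK.
rewrite dotpDr dotpNr; have := dotp_le g (z - y).
set t := enorm (z - y); set G := enorm g => gt xy.
have : 0 <= (2 * lam)^-1 * (t - lam * G) ^+ 2.
  by rewrite mulr_ge0 ?sqr_ge0 // invr_ge0 mulr_ge0 // ltW.
have -> : (2 * lam)^-1 * (t - lam * G) ^+ 2
  = (2 * lam)^-1 * t ^+ 2 - G * t + lam / 2 * G ^+ 2.
  by field; rewrite gt_eqF.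
by lra.
Qed.

(** The quadratic term makes the objective strongly convex: near-minimizers are
    close to one another. *)
Lemma prox_objective_midpoint z m y y' :
  (forall w, edom phi w -> m <= obj z w) -> edom phi y -> edom phi y' ->
  (2 * lam)^-1 * enorm (y - y') ^+ 2 / 2 <= (obj z y - m) + (obj z y' - m).
Proof.
move=> m_le y_dom y'_dom; have half : 0 <= (2^-1 : R) <= 1 by lra.
have [w_dom w_le] := econvex_fin _ _ _ y_dom y'_dom half.
have := m_le _ w_dom; set w := _ + _ in w_dom w_le *.
have E : enorm (z - w) ^+ 2 = enorm (z - y) ^+ 2 / 2
    + enorm (z - y') ^+ 2 / 2 - enorm (y - y') ^+ 2 / 4.
  have -> : z - w = 2^-1 *: (z - y) + 2^-1 *: (z - y').
    by apply/colP => i; rewrite !mxE; field.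
  have -> : y - y' = (z - y') - (z - y).
    by apply/colP => i; rewrite !mxE; ring.
  by rewrite !enorm_sqr !dotpE (dotpC y z) (dotpC y' z) (dotpC y' y); field.
by rewrite E; lra.
Qed.

(** A minimizing sequence is Cauchy by the midpoint estimate, and lower
    semicontinuity makes its limit a minimizer. *)
Lemma prox_exists z :
  argmin (fun y => (phi y + ((2 * lam)^-1 * enorm (z - y) ^+ 2)%:E)%E) !=set0.
Proof.
have c0 : 0 < (2 * lam)^-1 by rewrite invr_gt0 mulr_gt0.
have [m0 m0_le] := prox_objective_bounded z.
pose E := [set obj z y | y in edom phi]; pose m := inf E.
have hE : has_inf E.
  split; first by have [x x_dom] := proj2 phi_proper; exists (obj z x); exists x.
  by exists m0 => _ [y y_dom <-]; exact: m0_le.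
have m_le y : edom phi y -> m <= obj z y.
  by move=> y_dom; apply: ge_inf; [exact: (proj2 hE)|exists y].
have /choice[y yP] (k : nat) : exists y, edom phi y /\ obj z y < m + k.+1%:R^-1.
  have [|_ [y y_dom <-] ym] := @inf_adherent R E k.+1%:R^-1 _ hE.
    by rewrite invr_gt0.
  by exists y.
have inv_small (e : R) : 0 < e ->
    exists N, forall k, (N <= k)%N -> k.+1%:R^-1 < e.
  move=> e0; have [N _ Ne] := near_infty_natSinv_lt (PosNum e0).
  by exists N => k Nk; exact: Ne.
have [|ys ys_lim] := @cauchy_enorm_cvg R n y.
  move=> r r0.
  have [|N Nr] := inv_small ((2 * lam)^-1 * r ^+ 2 / 4).
    by rewrite divr_gt0 // mulr_gt0 // exprn_gt0.
  exists N => i j /Nr Ni /Nr Nj; have [yi yim] := yP i; have [yj yjm] := yP j.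
  have := prox_objective_midpoint z m _ _ m_le yi yj => yij.
  rewrite -(@ltr_pXn2r _ 2) // ?nnegrE ?enorm_ge0 ?ltW //.
  rewrite -(ltr_pM2l c0); move: yij yim yjm Ni Nj.
  move: (2 * lam)^-1 (i.+1%:R^-1) (j.+1%:R^-1) => c ei ej; lra.
have ys_le : (phi ys + ((2 * lam)^-1 * enorm (z - ys) ^+ 2)%:E <= m%:E)%E.
  rewrite leNgt; apply/negP => m_lt.
  set T := enorm (z - ys) in m_lt.
  have [e e0 ephi] : exists2 e : R, 0 < e &
      ((m - (2 * lam)^-1 * T ^+ 2 + e)%:E < phi ys)%E.
    move: m_lt; case: (phi ys) (proj1 phi_proper ys) => [r _||//].
      rewrite -EFinD lte_fin => mr.
      exists ((r + (2 * lam)^-1 * T ^+ 2 - m) / 2); first by lra.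
      by rewrite lte_fin; lra.
    by move=> _ _; exists 1 => //; exact: ltry.
  have [V Vys Vphi] := phi_lsc _ _ ephi.
  have T0 : 0 <= T by exact: enorm_ge0.
  move/cvg_enormP: (ys_lim) => ys_close.
  move/nbhs_enormP: Vys => [r r0 rV].
  pose r1 := Num.min r (e / (4 * (2 * lam)^-1 * (T + 1))).
  have r10 : 0 < r1 by rewrite lt_min r0 divr_gt0 // !mulr_gt0 //; lra.
  have [N1 N1y] := ys_close _ r10.
  have [|N2 N2e] := inv_small (e / 2); first by lra.
  pose k := maxn N1 N2.
  have [yk_dom yk_lt] := yP k.
  have yk_r1 := N1y k (leq_maxl _ _).
  have /rV/Vphi : enorm (y k - ys) < r.
    by rewrite (lt_le_trans yk_r1) // ge_min lexx.
  rewrite (edom_fin _ yk_dom) lte_fin => phi_yk.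
  have {}N2e := N2e k (leq_maxr _ _).
  move: (k.+1%:R^-1) N2e yk_lt => ek N2e yk_lt.
  have : T - enorm (z - y k) <= enorm (y k - ys).
    by rewrite lerBlDr addrC; exact: enorm_distD.
  set t := enorm (z - y k) in yk_lt * => Tt.
  have t0 : 0 <= t by exact: enorm_ge0.
  have : r1 * (4 * (2 * lam)^-1 * (T + 1)) <= e.
    rewrite -ler_pdivlMr ?ge_min ?lexx ?orbT // !mulr_gt0 //; lra.
  set c := (2 * lam)^-1 in c0 yk_lt phi_yk *.
  have : c * T ^+ 2 - c * (2 * T * r1) <= c * t ^+ 2.
    have : T ^+ 2 - 2 * T * r1 <= t ^+ 2 by apply: sqr_ge_sub => //; lra.
    by rewrite -(ler_pM2l c0); lra.
  have : 0 < c * r1 by rewrite mulr_gt0.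
  by lra.
exists ys => w /=; apply: (le_trans ys_le).
have [w_dom|w_ndom] := pselect (edom phi w).
  by rewrite (edom_fin _ w_dom) -EFinD lee_fin; exact: m_le.
have -> : phi w = +oo%E by apply/eqP; rewrite -leye_eq leNgt; exact/negP.
by rewrite addye // leey.
Qed.

(** Fermat's rule along the segments that leave the minimizer: after division by
    the parameter [t], only the linear part of the quadratic term survives the
    limit [t -> 0]. *)
Lemma prox_subdiff z :
  subdiff phi (prox lam phi z) (lam^-1 *: (z - prox lam phi z)).
Proof.
have := getPex (prox_exists z); rewrite -/(prox lam phi z).
set x := prox _ _ _ => x_min.
have x_dom : edom phi x.
  have [x0 x0_dom] := proj2 phi_proper; have := x_min x0.
  rewrite (edom_fin _ x0_dom) -EFinD => x_le; rewrite /edom /= ltNge leye_eq.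
  by apply/negP => /eqP phix; move: x_le; rewrite phix addye // leye_eq.
split=> // y.
have [y_dom|y_ndom] := pselect (edom phi y); last first.
  have -> : phi y = +oo%E by apply/eqP; rewrite -leye_eq leNgt; exact/negP.
  by rewrite leey.
rewrite (edom_fin _ x_dom) (edom_fin _ y_dom) -EFinD lee_fin -subr_ge0.
apply: (ge0_of_small_perturbation _ ((2 * lam)^-1 * enorm (y - x) ^+ 2)).
move=> t /andP[t0 t1].
have t01 : 0 <= t <= 1 by rewrite ltW.
have [w_dom w_le] := econvex_fin _ _ _ y_dom x_dom t01.
have := x_min (t *: y + (1 - t) *: x).
rewrite (edom_fin _ x_dom) (edom_fin _ w_dom) -!EFinD lee_fin.
have -> : z - (t *: y + (1 - t) *: x) = (z - x) - t *: (y - x).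
  by apply/colP => i; rewrite !mxE; ring.
rewrite !enorm_sqr !dotpE (dotpC y z) (dotpC x z) (dotpC x y) => x_le.
rewrite -(pmulr_rge0 _ t0).
have -> : lam^-1 = 2 * (2 * lam)^-1 by field; rewrite gt_eqF.
by lra.
Qed.

Lemma prox_edom z : edom phi (prox lam phi z).
Proof. by have [] := prox_subdiff z. Qed.

(** Monotonicity of the subdifferential, applied to the two proximal
    subgradients. *)
Lemma prox_firmly_nonexpansive z w :
  enorm (prox lam phi w - prox lam phi z) ^+ 2
  <= dotp (w - z) (prox lam phi w - prox lam phi z).
Proof.
have := subdiff_le _ _ _ (prox_subdiff z) (prox_edom w).
have := subdiff_le _ _ _ (prox_subdiff w) (prox_edom z).
move: (prox lam phi z) (prox lam phi w) => x y.
rewrite -(opprB y x) dotpNr !dotpZl => h1 h2.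
rewrite -subr_ge0 -(pmulr_rge0 _ (_ : 0 < lam^-1)) ?invr_gt0 //.
have -> : w - z = (w - y) - (z - x) + (y - x).
  by apply/colP => i; rewrite !mxE; ring.
by rewrite 2!dotpDl dotpNl enorm_sqr; lra.
Qed.

Lemma prox_nonexpansive z w :
  enorm (prox lam phi w - prox lam phi z) <= enorm (w - z).
Proof.
have := prox_firmly_nonexpansive z w.
move: (prox lam phi w - prox lam phi z) => v h; have := dotp_le (w - z) v.
move: h; set V := enorm v => h1 h2.
have [->|V0] := eqVneq V 0; first exact: enorm_ge0.
have Vpos : 0 < V by rewrite lt_def V0 enorm_ge0.
by rewrite -(ler_pM2r Vpos) -expr2 (le_trans h1).
Qed.

End Prox.

Section Taylor.
Context {R : realType} {n : nat} (f : 'cV[R]_n -> R).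
Context (f_diff : forall x, differentiable f x).

Lemma derive_dotp x v : 'D_v f x = dotp (gradient f x) v.
Proof.
rewrite deriveE // {1}(matrix_sum_delta v) linear_sum.
apply: eq_bigr => i _; rewrite linear_sum big_ord1 linearZ /= mxE -deriveE //.
by rewrite (ord1 0) mulrC.
Qed.

Lemma gradient_mean_value x y :
  exists2 t, 0 <= t <= 1 &
    f y - f x = dotp (gradient f (t *: y + (1 - t) *: x)) (y - x).
Proof.
pose g t := f (t *: (y - x) + x).
pose dg t := dotp (gradient f (t *: (y - x) + x)) (y - x).
have dgP t : is_derive t (1 : R) g (dg t).
  have E : (fun h : R => h^-1 *: ((g \o shift t) (h *: 1) - g t))
      = (fun h => h^-1 *: ((f \o shift (t *: (y - x) + x)) (h *: (y - x))
                           - f (t *: (y - x) + x))).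
    apply/funext => h; rewrite /g /= addrA -scalerDl.
    by rewrite /GRing.scale /= mulr1.
  have f_der := @diff_derivable _ _ _ _ _ (y - x) (f_diff (t *: (y - x) + x)).
  by split; [rewrite /derivable E|rewrite /derive E -[RHS]derive_dotp].
have [|t t01 gE] := @MVT_segment R g dg 0 1 ler01.
  by apply: derivable_within_continuous => t _; have [] := dgP t.
exists t; first by move: t01; rewrite in_itv.
have -> : t *: y + (1 - t) *: x = t *: (y - x) + x.
  by apply/colP => i; rewrite !mxE; ring.
by move: gE; rewrite /g /dg scale1r scale0r add0r subrK subr0 mulr1.
Qed.

(** The segment between two points of the domain lies in the domain, where the
    gradient is Lipschitz. *)
Lemma taylor_le (phi : 'cV[R]_n -> \bar R) (L : R) x y :
  econvex phi -> eproper phi -> 0 <= L ->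
  (forall x y, edom phi x -> edom phi y ->
     enorm (gradient f x - gradient f y) <= L * enorm (x - y)) ->
  edom phi x -> edom phi y ->
  `|f y - f x - dotp (gradient f x) (y - x)| <= L * enorm (y - x) ^+ 2.
Proof.
move=> phi_convex phi_proper L0 grad_lip x_dom y_dom.
have [t t01 ->] := gradient_mean_value x y.
have [w_dom _] := econvex_fin _ phi_convex phi_proper _ _ _ y_dom x_dom t01.
move: w_dom; set w := _ + _ => w_dom.
rewrite -dotpNl -dotpDl.
have wx : enorm (gradient f w - gradient f x) <= L * enorm (y - x).
  apply: (le_trans (grad_lip _ _ w_dom x_dom)); rewrite ler_wpM2l //.
  have -> : w - x = t *: (y - x) by apply/colP => i; rewrite !mxE; ring.
  by rewrite enormZ ger0_norm ?ler_piMl ?enorm_ge0 //; lra.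
have V0 := enorm_ge0 (y - x).
have := dotp_le (gradient f w - gradient f x) (y - x).
have := dotp_ge (gradient f w - gradient f x) (y - x).
have := ler_wpM2r V0 wx.
by rewrite ler_norml => *; apply/andP; split; lra.
Qed.

End Taylor.

(** * The merit estimate for one trial step *)

(** Along a step [s], [F] is the value of the normal map before it, [v] the
    displacement of the proximal point, [G] the change of the gradient and [psid]
    the change of the objective; [F + G + lam^-1 *: (s - v)] is then the value of
    the normal map after it. Firm nonexpansiveness, [|v| ^ 2 <= <s, v>], makes
    [<F, v>] at most [- |v| ^ 2 / (a lam)] up to terms of the second order in
    [a]. This negative term pays for the only first-order term without a sign,
    [<F, G>], because of the upper bound on [tau]. All other terms are of the
    second order and go into the constant [K]. *)
Lemma merit_decrease_estimate {R : realType} {n : nat}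
    (F e G v s : 'cV[R]_n) (a lam tau nuk l Lm X E psid : R) :
  let S := lam * (X + E) in
  let K1 := E + (Lm + lam^-1) * S in
  let K := 2 * E * S + Lm / 2 * S ^+ 2 + lam / 2 * X ^+ 2 + lam * X * E
           + lam / 2 * K1 ^+ 2 in
  s = (a * lam) *: (- F + a *: e) ->
  0 < a <= 1 -> 0 < lam -> 0 < tau <= 1 -> 0 <= l <= Lm ->
  tau * (l ^+ 2 * lam ^+ 2 + 2) <= 2 * (1 - nuk) ->
  enorm F <= X -> enorm e <= E ->
  enorm G <= l * enorm v -> enorm v ^+ 2 <= dotp s v -> enorm v <= enorm s ->
  psid <= dotp F v + lam^-1 * dotp s v - lam^-1 * enorm v ^+ 2
          + l / 2 * enorm v ^+ 2 ->
  psid + tau * lam / 2 *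
    (enorm (F + G + lam^-1 *: (s - v)) ^+ 2 - enorm F ^+ 2)
  <= - (tau * lam * a / 2 * enorm F ^+ 2) - nuk / (lam * a) * enorm v ^+ 2
     + a ^+ 2 * K.
Proof.
move=> S K1 K sE /andP[a0 a1] lam0 /andP[tau0 tau1] /andP[l0 lLm] tau_le FX eE.
move=> Gl vs vn psid_le.
have X0 : 0 <= X := le_trans (enorm_ge0 _) FX.
have E0 : 0 <= E := le_trans (enorm_ge0 _) eE.
have Lm0 : 0 <= Lm := le_trans l0 lLm.
have [a0' lam0' tau0'] : [/\ 0 <= a, 0 <= lam & 0 <= tau] by split; exact: ltW.
have S0 : 0 <= S by rewrite mulr_ge0 ?addr_ge0.
have [lamN0 aN0] : lam != 0 /\ a != 0 by rewrite !gt_eqF.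
set il := lam^-1 in psid_le *.
have il0 : 0 < il by rewrite invr_gt0.
have il0' := ltW il0.
have lil : lam * il = 1 by rewrite mulfV.
set V := enorm v in Gl vs vn psid_le *; set x := enorm F in FX *.
have V0 : 0 <= V := enorm_ge0 _.
have x0 : 0 <= x := enorm_ge0 _.
have VS : V <= a * S.
  apply: (le_trans vn); rewrite sE enormZ gtr0_norm ?mulr_gt0 // -mulrA.
  rewrite ler_pM2l // /S ler_pM2l //; apply: (le_trans (enormD _ _)).
  rewrite enormN lerD // enormZ gtr0_norm // (le_trans _ eE) //.
  by rewrite ler_piMl ?enorm_ge0.
clearbody S.
have aS1 : a * S <= S by rewrite ler_piMl.
have VV : V ^+ 2 <= a ^+ 2 * S ^+ 2.
  by rewrite -exprMn ler_pXn2r ?nnegrE ?mulr_ge0.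
have R2 : enorm (a ^+ 2 *: e + G - il *: v) ^+ 2 <= a ^+ 2 * K1 ^+ 2.
  rewrite -exprMn ler_pXn2r ?nnegrE ?enorm_ge0 //; last first.
    by rewrite mulr_ge0 ?addr_ge0 ?mulr_ge0 ?addr_ge0.
  apply: (le_trans (enormD _ _)); rewrite enormN enormZ gtr0_norm // -/V.
  have := enormD (a ^+ 2 *: e) G; rewrite enormZ ger0_norm ?sqr_ge0 //.
  have : a ^+ 2 * enorm e <= a * E.
    by rewrite expr2 -mulrA ler_pM2l // (le_trans _ eE) // ler_piMl ?enorm_ge0.
  have : l * V <= Lm * (a * S) by exact: ler_pM.
  have : il * V <= il * (a * S) by rewrite ler_pM2l.
  by rewrite /K1 -/il; lra.
have FpE : enorm (F + G + il *: (s - v)) ^+ 2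
    = (1 - a) ^+ 2 * x ^+ 2 + 2 * (1 - a) *
      (a ^+ 2 * dotp F e + dotp F G - il * dotp F v)
      + enorm (a ^+ 2 *: e + G - il *: v) ^+ 2.
  have -> : F + G + il *: (s - v)
      = (1 - a) *: F + (a ^+ 2 *: e + G - il *: v).
    by rewrite sE; apply/colP => i; rewrite !mxE /il; field.
  have <- : dotp F (a ^+ 2 *: e + G - il *: v)
      = a ^+ 2 * dotp F e + dotp F G - il * dotp F v by rewrite !dotpE.
  move: (_ + G - _) => w; rewrite /x !enorm_sqr !dotpE (dotpC w F); ring.
rewrite FpE.
have svE : dotp s v = a * lam * (- dotp F v + a * dotp e v).
  by rewrite sE !dotpE.
have fe_le : dotp F e <= X * E.
  by apply: (le_trans (dotp_le _ _)); rewrite ler_pM ?enorm_ge0.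
have fg_le : dotp F G <= x * (l * V).
  by apply: (le_trans (dotp_le _ _)); rewrite ler_wpM2l.
have ev_le : dotp e v <= E * (a * S).
  by apply: (le_trans (dotp_le _ _)); rewrite ler_pM ?enorm_ge0.
move: psid_le vs; rewrite svE; move: (dotp F v) (dotp e v) (dotp F e) (dotp F G)
  (enorm (_ + _ - _) ^+ 2) fe_le fg_le ev_le R2 => fv ev fe fg rr.
move=> fe_le fg_le ev_le R2 psid_le vs.
clear FpE svE sE vn Gl; clearbody il V x K1.
have la0 : 0 < lam * a by rewrite mulr_gt0.
pose om := V ^+ 2 / (lam * a).
have om0 : 0 <= om by rewrite divr_ge0 ?sqr_ge0 ?mulr_ge0.
have omE : V ^+ 2 = lam * a * om by rewrite /om; field; rewrite aN0.
clearbody om.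
have fv_le : fv <= - om + a * ev.
  by rewrite -(ler_pM2l la0); move: vs; rewrite omE; lra.
have c0 : 0 <= (1 - a) * (1 - tau) by rewrite mulr_ge0 //; lra.
have h1 := ler_wpM2l c0 fv_le.
have h2 : (1 - a) * (1 - tau) * (a * ev) <= a ^+ 2 * (E * S).
  apply: (@le_trans _ _ ((1 - a) * (1 - tau) * (a ^+ 2 * (E * S)))).
    by rewrite ler_wpM2l // expr2 -mulrA ler_wpM2l // (le_trans ev_le) //; lra.
  by rewrite ler_piMl ?mulr_ge0 ?sqr_ge0 // -[leRHS]mulr1 ler_pM //; lra.
have h3 : a ^+ 2 * ev <= a ^+ 2 * (E * S).
  by rewrite ler_pM2l ?exprn_gt0 // (le_trans ev_le) // ler_wpM2l.
have h4 : l / 2 * V ^+ 2 <= Lm / 2 * (a ^+ 2 * S ^+ 2).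
  by rewrite ler_pM ?sqr_ge0 //; lra.
have lt0 : 0 <= tau * lam by rewrite mulr_ge0.
have lt1 : tau * lam <= lam by rewrite ler_piMl.
have h5 : tau * lam * (a ^+ 2 * x ^+ 2) <= lam * (a ^+ 2 * X ^+ 2).
  by rewrite ler_pM ?mulr_ge0 ?sqr_ge0 // ler_wpM2l ?sqr_ge0 // ler_pXn2r.
have d0 : 0 <= tau * lam * (1 - a) by rewrite mulr_ge0 // subr_ge0.
have d1 : tau * lam * (1 - a) <= tau * lam by rewrite ler_piMr // gerBl.
have h6 : tau * lam * (1 - a) * (a ^+ 2 * fe) <= lam * (a ^+ 2 * (X * E)).
  apply: (@le_trans _ _ (tau * lam * (1 - a) * (a ^+ 2 * (X * E)))).
    by rewrite ler_wpM2l // ler_wpM2l ?sqr_ge0.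
  by rewrite ler_wpM2r ?mulr_ge0 ?sqr_ge0 // (le_trans d1).
have h7 : tau * lam * (1 - a) * fg <= tau * lam * (x * (l * V)).
  apply: (@le_trans _ _ (tau * lam * (1 - a) * (x * (l * V)))).
    by rewrite ler_wpM2l.
  by rewrite ler_wpM2r // mulr_ge0 // mulr_ge0.
have h8 : tau * lam * rr <= lam * (a ^+ 2 * K1 ^+ 2).
  apply: (@le_trans _ _ (tau * lam * (a ^+ 2 * K1 ^+ 2))).
    by rewrite ler_wpM2l.
  by rewrite ler_wpM2r // mulr_ge0 // sqr_ge0.
(* Young's inequality splits the only term of the first order in [a] that is
   not signed *)
have h9 : tau * lam * (x * (l * V))
    <= tau * lam * a / 2 * x ^+ 2 + tau * l ^+ 2 * lam ^+ 2 / 2 * om.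
  have : 0 <= tau * lam / (2 * a) * (a * x - l * V) ^+ 2.
    by rewrite mulr_ge0 ?sqr_ge0 // divr_ge0 ?mulr_ge0.
  rewrite sqrrB exprMn [(l * V) ^+ 2]exprMn omE.
  have -> : tau * lam / (2 * a) * (a ^+ 2 * x ^+ 2 - a * x * (l * V) *+ 2 +
     l ^+ 2 * (lam * a * om)) = tau * lam * a / 2 * x ^+ 2
     + tau * l ^+ 2 * lam ^+ 2 / 2 * om - tau * lam * (x * (l * V)).
    by field.
  by rewrite subr_ge0.
have h10 := ler_wpM2r om0 tau_le.
have nuE : nuk / (lam * a) * V ^+ 2 = nuk * om.
  by rewrite omE; field; rewrite aN0.
rewrite nuE.
have ilV : il * V ^+ 2 = a * om.
  by transitivity (a * om * (lam * il)); [rewrite omE; ring|rewrite lil mulr1].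
have il_fv : tau * lam / 2 * (2 * (1 - a) * (il * fv)) = tau * (1 - a) * fv.
  by transitivity (tau * (1 - a) * fv * (lam * il)); [field|rewrite lil mulr1].
have il_sv : il * (a * lam * (- fv + a * ev)) = a * (- fv + a * ev).
  by transitivity (a * (- fv + a * ev) * (lam * il)); [ring|rewrite lil mulr1].
have aom : 0 <= a * tau * om by rewrite !mulr_ge0.
rewrite il_sv ilV in psid_le.
apply: (@le_trans _ _ ((1 - a) * fv + a ^+ 2 * ev - a * om + l / 2 * V ^+ 2
  + (tau * lam / 2 * ((1 - a) ^+ 2 * x ^+ 2 - x ^+ 2)
  + tau * lam * (1 - a) * (a ^+ 2 * fe) + tau * lam * (1 - a) * fg
  - tau * (1 - a) * fv + tau * lam / 2 * rr))).
  by rewrite -il_fv; lra.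
by rewrite /K; lra.
Qed.

(** * Logarithmic weights, telescoping sums and desingularizing functions *)

Section LogWeights.
Context {R : realType}.

(** [1 / ln k - 1 / ln (k + 1)] is at least [ln (1 + 1 / k) / ln (k + 1) ^ 2], and
    [ln (1 + 1 / k)] is at least [1 / (k + 1)], hence at least [1 / (2 k)]. *)
Lemma inv_log_weight_le (k : nat) : (2 <= k)%N ->
  (log_weight k : R)^-1 <= 2 / ln k%:R - 2 / ln k.+1%:R.
Proof.
move=> k2; have k1 : (1 : R) < k%:R by rewrite ltr1n.
have k1' : (1 : R) < k.+1%:R by rewrite ltr1n ltnW.
have kE : k.+1%:R = k%:R + 1 :> R by rewrite -natr1.
have a0 := ln_gt0 k1; have b0 := ln_gt0 k1'.
have lnB : ln (k%:R : R) + (k.+1%:R)^-1 <= ln k.+1%:R.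
  have : ln (1 + - (k.+1%:R)^-1 : R) <= - (k.+1%:R)^-1.
    by apply: le_ln1Dx; rewrite ltrN2 invf_lt1 // ltW.
  have -> : 1 + - (k.+1%:R)^-1 = k%:R / k.+1%:R :> R.
    by rewrite kE; field; rewrite -kE gt_eqF // ltr0n.
  rewrite ln_div ?posrE ?ltr0n //; last exact: ltnW.
  by move: (ln (k.+1%:R : R)) (k.+1%:R^-1 : R) => *; lra.
rewrite /log_weight; move: lnB a0 b0; rewrite kE in k1' *.
move: (k%:R : R) k1 {kE} k1' => x x1 x1'.
move: (ln x) (ln (x + 1)) => a b lnB a0 b0.
have x0 : 0 < x by lra.
have iE : (x + 1)^-1 * (x + 1) = 1 by rewrite mulVf // gt_eqF //; lra.
have i0 : 0 < (x + 1)^-1 by rewrite invr_gt0; lra.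
move: (x + 1)^-1 i0 iE lnB => i i0 iE lnB.
have ab : a <= b by lra.
have -> : 2 / a - 2 / b = 2 * (b - a) / (a * b) by field; rewrite !gt_eqF.
rewrite -div1r ler_pdivlMr ?mulr_gt0 // mulrAC.
rewrite ler_pdivrMr ?mulr_gt0 ?exprn_gt0 //.
rewrite mul1r.
have h1 : 1 <= 2 * (b - a) * x.
  have : i * x <= (b - a) * x by rewrite ler_pM2r //; lra.
  have : 0 <= i * (x - 1) by rewrite mulr_ge0 //; lra.
  by lra.
have : a * b <= b ^+ 2 by rewrite expr2 ler_pM2r.
have : b ^+ 2 <= 2 * (b - a) * x * b ^+ 2 by rewrite ler_peMl ?sqr_ge0.
lra.
Qed.

Lemma inv_ln_small (e : R) : 0 < e ->
  exists N, forall k, (N <= k)%N -> 2 / ln k%:R < e.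
Proof.
move=> e0; pose y := expR (2 / e + 1).
have [N Ny] : exists N : nat, y < N%:R.
  by exists (Num.truncn y).+1; rewrite truncnS_gt.
exists N => k Nk.
have yk : y < k%:R by rewrite (lt_le_trans Ny) // ler_nat.
have y0 : 0 < y by exact: expR_gt0.
have e20 : 0 < 2 / e by rewrite divr_gt0.
have lnk : 2 / e < ln k%:R.
  apply: (@lt_trans _ _ (ln y)); first by rewrite expRK; lra.
  by rewrite ltr_ln // posrE // (lt_trans y0).
by rewrite ltr_pdivrMr ?(lt_trans e20) // mulrC -ltr_pdivrMr.
Qed.

(** Below the cap [nu < 1], the factor [a_k^2 V^(2p) = (log_weight k * V)^(2p)]
    is less than [1], and so is its base. *)
Lemma trial_nu_alt {n : nat} (P : params R) k (x y : 'cV[R]_n) :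
  admissible P -> (0 < k)%N ->
  trial_nu P k x y = nu P \/ enorm (y - x) <= (log_weight k)^-1.
Proof.
move=> [_ _ [_ _ _ /andP[_ nu1]] [_ p0 _]] k0.
rewrite /trial_nu; have [_|lt_nu] := leP (nu P) _; [by left|right].
have w0 : 0 < log_weight k :> R.
  by rewrite mulr_gt0 ?ltr0n // exprn_gt0 // ln_gt0 // ltr1n.
rewrite -[leRHS]mulr1 ler_pdivlMl //.
rewrite leNgt; apply/negP => lt1.
have : 1 <= a_seq P k ^+ 2 * enorm (y - x) `^ (2 * expp P).
  have -> : a_seq P k ^+ 2 = log_weight k `^ (2 * expp P) :> R.
    by rewrite /a_seq -powR_mulrn ?powR_ge0 // -powRrM mulrC.
  rewrite -powRM ?enorm_ge0 ?(ltW w0) //.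
  apply: (@le_trans _ _ (1 `^ (2 * expp P))); first by rewrite powR1.
  have p20 : 0 <= 2 * expp P by rewrite mulr_ge0 // ltW.
  by apply: (ge0_ler_powR p20); rewrite ?nnegrE ?(le_trans ler01) // ltW.
by rewrite leNgt (lt_trans lt_nu).
Qed.

Lemma b_seq_ge (P : params R) k : admissible P -> (0 < k)%N ->
  0 < b_seq P 1 <= b_seq P k.
Proof.
move=> [_ _ _ [q0 _ _]] k0.
have w0 : 0 < log_weight 1 :> R.
  by rewrite mulr_gt0 ?ltr0n // exprn_gt0 // ln_gt0 // ltr1n.
rewrite powR_gt0 //= ge0_ler_powR ?(ltW q0) ?nnegrE ?(ltW w0) //.
  by rewrite mulr_ge0 ?sqr_ge0.
rewrite ler_pM ?sqr_ge0 ?ler_nat // ler_pXn2r ?nnegrE ?ln_ge0 ?ler1n //.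
by rewrite ler_ln ?posrE ?ltr0n // ler_nat ltnS.
Qed.

End LogWeights.

Section Telescoping.
Context {R : realType}.

Lemma nonincreasing_no_repeated_drop (h : nat -> R) (m e : R) :
  0 < e -> (forall k, h k.+1 <= h k) ->
  (forall N, exists k, [/\ (N <= k)%N, h k.+1 <= h k - e & m <= h k]) -> False.
Proof.
move=> e0 h_dec h_drop.
have h_mono i j : (i <= j)%N -> h j <= h i.
  elim: j => [|j IH]; first by rewrite leqn0 => /eqP ->.
  rewrite leq_eqVlt => /orP[/eqP -> //|ij].
  exact: le_trans (h_dec j) (IH ij).
have drops j : exists k, h k <= h 0%N - j%:R * e.
  elim: j => [|j [N hN]]; first by exists 0%N; rewrite mul0r subr0.
  have [k [Nk hk _]] := h_drop N; exists k.+1.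
  by have := h_mono _ _ Nk; rewrite -natr1; lra.
have [j ij] : exists j : nat, (h 0%N - m) / e < j%:R.
  by exists (Num.truncn ((h 0%N - m) / e)).+1; rewrite truncnS_gt.
have [N hN] := drops j; have [k [Nk _ mk]] := h_drop N.
move: ij; rewrite ltr_pdivrMr //; have := h_mono _ _ Nk; lra.
Qed.

Lemma telescoping_bound (V Psi : nat -> R) N k :
  (forall i, (N <= i)%N -> V i <= Psi i - Psi i.+1) -> (N <= k)%N ->
  \sum_(N <= i < k) V i <= Psi N - Psi k.
Proof.
move=> VP /subnK <-; elim: (k - N)%N => [|d IH].
  by rewrite add0n big_geq // subrr.
rewrite addSn big_nat_recr ?leq_addl //=.
by have := VP _ (leq_addl d N); lra.
Qed.

Lemma nneseries_lt_pinfty (V : nat -> R) N (M : R) :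
  (forall k, 0 <= V k) ->
  (forall k, (N <= k)%N -> \sum_(N <= i < k) V i <= M) ->
  (\sum_(0 <= k <oo) (V k)%:E < +oo)%E.
Proof.
move=> V0 VM; apply: (@le_lt_trans _ _ (\sum_(0 <= i < N) V i + M)%:E);
  last exact: ltry.
apply: lime_le; first by apply: is_cvg_nneseries => k _ _; rewrite lee_fin.
exists N => // k /= Nk; rewrite sumEFin lee_fin (big_cat_nat (n := N)) //=.
by rewrite lerD2l VM.
Qed.

End Telescoping.

Lemma quadratic_small {R : realType} (M e : R) : 0 <= M -> 0 < e ->
  exists2 r : R, 0 < r & forall d, 0 <= d -> d < r -> M * d ^+ 2 < e.
Proof.
move=> M0 e0; have M1 : 0 < M + 1 by lra.
exists (Num.min 1 (e / (M + 1))); first by rewrite lt_min ltr01 divr_gt0.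
move=> d d0; rewrite lt_min ltr_pdivlMr // => /andP[d1 de].
have : M * d ^+ 2 <= M * d by rewrite ler_wpM2l // expr2 ler_piMl // ltW.
by lra.
Qed.

(** The two parts of the decrease enter with reciprocal step sizes, so by the
    arithmetic-geometric mean inequality the decrease dominates the product of
    the residual and the step length, whatever the step size is. *)
Lemma step_le_potential {R : realType} (m al c v x y s s' p p' : R) :
  0 < m -> 0 < al -> 0 < c -> m <= x -> m <= y ->
  x * al * c ^+ 2 + y * (v ^+ 2 / al) <= s - s' ->
  s - s' <= c * (p - p') -> v <= (2 * m)^-1 * (p - p').
Proof.
move=> m0 al0 c0 mx my dec pot.
have amgm : 2 * (c * v) <= al * c ^+ 2 + v ^+ 2 / al.
  have : 0 <= (al * c - v) ^+ 2 / al by rewrite divr_ge0 ?sqr_ge0 // ltW.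
  have -> : (al * c - v) ^+ 2 / al
    = al * c ^+ 2 + v ^+ 2 / al - 2 * (c * v) by field; rewrite gt_eqF.
  by rewrite subr_ge0.
have va0 : 0 <= v ^+ 2 / al by rewrite divr_ge0 ?sqr_ge0 // ltW.
have ac0 : 0 <= al * c ^+ 2 by rewrite mulr_ge0 ?sqr_ge0 // ltW.
have h1 := ler_wpM2r ac0 mx; have h2 := ler_wpM2r va0 my.
have h3 : m * (2 * (c * v)) <= m * (al * c ^+ 2 + v ^+ 2 / al).
  by rewrite ler_pM2l.
rewrite mulrC ler_pdivlMr ?mulr_gt0 // -(ler_pM2l c0).
rewrite -[x * al * _]mulrA in dec.
by move: (al * c ^+ 2) (v ^+ 2 / al) dec h1 h2 h3 => *; lra.
Qed.

Section ControlledPath.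
Context {R : realType} {n : nat}.
Context (x : nat -> 'cV[R]_n) (xbar : 'cV[R]_n) (Psi : nat -> R) (r : R).
Context (N0 : nat) (r_gt0 : 0 < r) 
  (Psi_ge0 : forall k, (N0 <= k)%N -> 0 <= Psi k).
Context (Psi_small : forall e : R, 0 < e ->
  exists N, forall k, (N <= k)%N -> Psi k < e).
Context (x_near : forall (e : R) N, 0 < e ->
  exists2 k, (N <= k)%N & enorm (x k - xbar) < e).
Context (x_step : forall k, (N0 <= k)%N -> enorm (x k - xbar) < r ->
  enorm (x k.+1 - x k) <= Psi k - Psi k.+1).

(** Once an iterate is close enough to the limit point, the remaining path is
    too short to leave the ball in which the steps are controlled. *)
Lemma path_eventually_controlled :
  exists2 N, (N0 <= N)%N & forall k, (N <= k)%N ->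
    enorm (x k.+1 - x k) <= Psi k - Psi k.+1.
Proof.
have r2 : 0 < r / 2 by rewrite divr_gt0.
have [N1 N1P] := Psi_small _ r2.
have [N NN xN] := x_near _ (maxn N0 N1) r2.
have [N0N N1N] : (N0 <= N)%N /\ (N1 <= N)%N.
  by move: NN; rewrite geq_max => /andP.
have PN := N1P _ N1N; exists N => // k Nk.
suff xk : enorm (x k - x N) <= Psi N - Psi k.
  apply: x_step; first exact: leq_trans Nk.
  apply: (le_lt_trans (enorm_distD (x N) _ _)).
  by have := Psi_ge0 _ (leq_trans N0N Nk); lra.
move: Nk => /subnK <-; elim: (k - N)%N => [|d IH].
  by rewrite add0n !subrr enorm0.
rewrite addSn; apply: (le_trans (enorm_distD (x (d + N)%N) _ _)).
have N0d : (N0 <= d + N)%N by rewrite (leq_trans N0N) // leq_addl.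
have xd : enorm (x (d + N)%N - xbar) < r.
  apply: (le_lt_trans (enorm_distD (x N) _ _)).
  by have := Psi_ge0 _ N0d; lra.
by have := x_step _ N0d xd; lra.
Qed.

Lemma controlled_path_cvg (e : R) : 0 < e ->
  exists N, forall k, (N <= k)%N -> enorm (x k - xbar) < e.
Proof.
move=> e0; have [N1 N0N1 N1P] := path_eventually_controlled.
have e2 : 0 < e / 2 by rewrite divr_gt0.
have [N2 N2P] := Psi_small _ e2.
exists (maxn N1 N2) => k; rewrite geq_max => /andP[N1k N2k].
have [m km xm] := x_near _ k e2.
have dist : enorm (x m - x k) <= Psi k - Psi m.
  move: {xm} km => /subnK <-; elim: (m - k)%N => [|d IH].
    by rewrite add0n !subrr enorm0.
  rewrite addSn; apply: (le_trans (enorm_distD (x (d + k)%N) _ _)).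
  have N1d : (N1 <= d + k)%N by rewrite (leq_trans N1k) // leq_addl.
  by have := N1P _ N1d; lra.
have Pm : 0 <= Psi m by rewrite Psi_ge0 // (leq_trans N0N1) // (leq_trans N1k).
have Pk := N2P _ N2k.
apply: (le_lt_trans (enorm_distD (x m) _ _)); rewrite [enorm (x k - _)]enormB.
by lra.
Qed.

End ControlledPath.

Section Desingularization.
Context {R : realType}.

(** A concave function lies below its tangents; at the interior points of the
    domain the difference quotients along a chord converge to the slope. *)
Lemma desingularizing_tangent (eta : \bar R) (h : R -> R) (a b : R) :
  desingularizing eta h -> 0 < a -> (a%:E < eta)%E -> 0 <= b ->
  (b%:E < eta)%E -> h b <= h a + derive1 h a * (b - a).
Proof.
move=> [_ h_conv _ _ h_der] a0 a_eta b0 b_eta.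
have [ha _ _] := h_der _ a0 a_eta.
have Da : a \in [set t : R | (0 <= t)%R /\ (t%:E < eta)%E].
  by rewrite inE /=; split => //; exact: ltW.
have Db : b \in [set t : R | (0 <= t)%R /\ (t%:E < eta)%E] by rewrite inE.
have chord (s : R) : 0 < s -> s < 1 ->
    s * (h b - h a) <= h (s * (b - a) + a) - h a.
  move=> s0 s1.
  have : - h (s * b + (1 - s) * a) <= s * - h b + (1 - s) * - h a.
    exact: (h_conv (Itv01 (ltW s0) (ltW s1)) _ _ Db Da).
  have -> : s * b + (1 - s) * a = s * (b - a) + a by ring.
  by lra.
have [->|ab] := eqVneq b a; first by rewrite subrr mulr0 addr0.
have ba : 0 < `|b - a| by rewrite normr_gt0 subr_eq0.
apply/ler_addgt0Pr => e e0.
have e1 : 0 < e / `|b - a| by rewrite divr_gt0.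
move: (ha) => /cvgrPdist_lt /(_ _ e1); rewrite -/(derive h a 1) -derive1E.
move=> /nbhs_ballP[d /= d0 dP].
pose s := Num.min 2^-1 (d / (2 * `|b - a|)).
have s0 : 0 < s by rewrite lt_min invr_gt0 ltr0n /= divr_gt0 // mulr_gt0.
have s1 : s < 1 by rewrite gt_min; apply/orP; left; rewrite invf_lt1 ?ltr1n.
have sd : s * `|b - a| <= d / 2.
  have : s <= d / (2 * `|b - a|) by rewrite ge_min lexx orbT.
  rewrite ler_pdivlMr ?mulr_gt0 //.
  by move: (`|b - a|) => *; lra.
have t0 : s * (b - a) != 0 by rewrite mulf_neq0 ?subr_eq0 // gt_eqF.
have := dP (s * (b - a)); rewrite -ball_normE /= sub0r normrN normrM gtr0_norm //.
have sd' : s * `|b - a| < d by lra.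
move=> /(_ sd' t0); rewrite /GRing.scale /= mulr1.
set q := _^-1 * _ => hq.
have qE : h (s * (b - a) + a) - h a = s * (b - a) * q.
  by rewrite /q mulrA divff // mul1r.
have := chord _ s0 s1; rewrite qE -mulrA ler_pM2l // => hba.
have : `|(b - a) * (h^`()%classic a - q)| <= e.
  rewrite normrM mulrC -ler_pdivlMr //; exact: ltW.
move: hba; rewrite ler_norml mulrBr; lra.
Qed.

Lemma desingularizing_small (eta : \bar R) (h : R -> R) (e : R) :
  desingularizing eta h -> (0 < eta)%E -> 0 < e ->
  exists2 d : R, 0 < d & forall t, 0 <= t < d -> (t%:E < eta)%E -> h t < e.
Proof.
move=> [h_cont _ _ h0 _] eta0 e0.
have D0 : [set t : R | (0 <= t)%R /\ (t%:E < eta)%E] 0 by split.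
have : h t @[t --> within [set t : R | (0 <= t)%R /\ (t%:E < eta)%E] (nbhs 0)]
    --> h 0 by exact: (subspace_continuousP _ _).1 h_cont _ D0.
move=> /cvgrPdist_lt /(_ _ e0) /nbhs_ballP[d /= d0 dP].
exists d => // t /andP[t0 td] t_eta.
have := dP t; rewrite -ball_normE /= sub0r normrN ger0_norm // => /(_ td).
move=> /(_ (conj t0 t_eta)); rewrite h0 sub0r normrN.
by apply: le_lt_trans; exact: ler_norm.
Qed.

(** A desingularizing function for the merit values. Its first term takes over
    when at least half of the merit excess is an excess of the objective; when
    most of it is the squared residual, the square root desingularizes it. *)
Definition merit_potential (h : R -> R) (A s : R) : R :=
  2 * h (s / 2) + 2 * Num.sqrt (2 * A) * Num.sqrt s.

Lemma merit_potential_decrease (eta : \bar R) (h : R -> R)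
    (s s' c A A0 D : R) :
  desingularizing eta h -> 0 < s -> (s%:E < eta)%E -> 0 <= s' <= s ->
  0 <= c -> s = D + A * c ^+ 2 -> 0 <= A <= A0 ->
  (0 < D -> (D%:E < eta)%E -> 1 <= derive1 h D * c) ->
  s - s' <= c * (merit_potential h A0 s - merit_potential h A0 s').
Proof.
move=> h_des s0 s_eta /andP[s'0 s's] c0 sE /andP[A_ge0 A_le] kl.
have half t : 0 <= t <= s -> ((t / 2)%:E < eta)%E.
  by move=> /andP[t0 ts]; apply: le_lt_trans s_eta; rewrite lee_fin; lra.
have s2_eta : ((s / 2)%:E < eta)%E by apply: half; lra.
have s2' : ((s' / 2)%:E < eta)%E by apply: half; rewrite s'0.
have s20 : 0 < s / 2 by lra.
have [_ _ _ _ h_der] := h_des.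
have [_ _ h's] := h_der _ s20 s2_eta.
have tan : h (s' / 2) <= h (s / 2) + derive1 h (s / 2) * (s' / 2 - s / 2).
  by apply: desingularizing_tangent h_des _ _ _ _ => //; lra.
have d_sqrt : Num.sqrt s' <= Num.sqrt s by rewrite ler_wsqrtr.
have A00 : 0 <= 2 * A0 by lra.
have B0 := sqrtr_ge0 (2 * A0).
rewrite /merit_potential.
have [D_ge|D_lt] := leP (s / 2) D.
  have Ac : 0 <= A * c ^+ 2 by rewrite mulr_ge0 ?sqr_ge0.
  have D0 : 0 < D by lra.
  have D_eta : (D%:E < eta)%E by apply: le_lt_trans s_eta; rewrite lee_fin; lra.
  have tanD : h (s / 2) <= h D + derive1 h D * (s / 2 - D).
    by apply: desingularizing_tangent h_des _ _ _ _ => //; lra.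
  have tanS : h D <= h (s / 2) + derive1 h (s / 2) * (D - s / 2).
    by apply: desingularizing_tangent h_des _ _ _ _ => //; lra.
  have h_anti : derive1 h D <= derive1 h (s / 2).
    have [DE|DN] := eqVneq D (s / 2); first by rewrite DE.
    have gap : 0 < D - s / 2 by rewrite subr_gt0 lt_def DN.
    by rewrite -(ler_pM2r gap); lra.
  have key : 1 <= derive1 h (s / 2) * c.
    by apply: (le_trans (kl D0 D_eta)); rewrite ler_wpM2r.
  have k1 : 0 <= (derive1 h (s / 2) * c - 1) * (s - s').
    by rewrite mulr_ge0 // subr_ge0.
  have k2 : c * (2 * (derive1 h (s / 2) * (s / 2 - s' / 2)))
      <= c * (2 * h (s / 2) - 2 * h (s' / 2)).
    by rewrite ler_wpM2l //; lra.
  have k3 : 0 <= c * (2 * Num.sqrt (2 * A0) * (Num.sqrt s - Num.sqrt s')).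
    by rewrite mulr_ge0 // mulr_ge0 ?subr_ge0 // mulr_ge0.
  by lra.
have cB : Num.sqrt s <= c * Num.sqrt (2 * A0).
  have A0c : s <= 2 * A0 * c ^+ 2.
    have : A * c ^+ 2 <= A0 * c ^+ 2 by rewrite ler_wpM2r ?sqr_ge0.
    by lra.
  apply: (le_trans (ler_wsqrtr A0c)).
  by rewrite sqrtrM // sqrtr_sqr ger0_norm // mulrC.
have h_mono : h (s' / 2) <= h (s / 2).
  have : 0 <= derive1 h (s / 2) * (s / 2 - s' / 2).
    by rewrite mulr_ge0 ?(ltW h's) //; lra.
  by lra.
have k1 : 0 <= c * (2 * (h (s / 2) - h (s' / 2))).
  by rewrite mulr_ge0 // mulr_ge0 // subr_ge0.
have k2 : Num.sqrt s * (Num.sqrt s - Num.sqrt s')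
    <= c * Num.sqrt (2 * A0) * (Num.sqrt s - Num.sqrt s').
  by rewrite ler_wpM2r // subr_ge0.
have k3 : s - s' <= 2 * (Num.sqrt s * (Num.sqrt s - Num.sqrt s')).
  rewrite -{1}(sqr_sqrtr (ltW s0)) -{1}(sqr_sqrtr s'0).
  by have := sqr_ge0 (Num.sqrt s - Num.sqrt s'); lra.
by lra.
Qed.

Lemma merit_potential_ge0 (eta : \bar R) (h : R -> R) (A s : R) :
  desingularizing eta h -> 0 <= s -> (s%:E < eta)%E ->
  0 <= merit_potential h A s.
Proof.
move=> [_ _ h_ge0 _ _] s0 s_eta; rewrite addr_ge0 ?mulr_ge0 ?sqrtr_ge0 //.
by apply: h_ge0; split; [lra|apply: le_lt_trans s_eta; rewrite lee_fin; lra].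
Qed.

Lemma merit_potential_small (eta : \bar R) (h : R -> R) (A e : R) :
  desingularizing eta h -> (0 < eta)%E -> 0 < e ->
  exists2 d : R, 0 < d & forall s, 0 <= s < d -> (s%:E < eta)%E ->
    merit_potential h A s < e.
Proof.
move=> h_des eta0 e0.
have e4 : 0 < e / 4 by rewrite divr_gt0.
have [d d0 dP] := desingularizing_small _ _ _ h_des eta0 e4.
pose B := Num.sqrt (2 * A); have B0 : 0 <= B := sqrtr_ge0 _.
pose w := e / (4 * (B + 1)).
have w0 : 0 < w by rewrite divr_gt0 // mulr_gt0 //; lra.
have wE : w * (4 * (B + 1)) = e.
  by rewrite /w divfK // gt_eqF // mulr_gt0 //; lra.
exists (Num.min d (w ^+ 2)); first by rewrite lt_min d0 exprn_gt0.
move=> s /andP[s0]; rewrite lt_min => /andP[sd sw] s_eta.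
have hs : h (s / 2) < e / 4.
  apply: dP; first by apply/andP; split; lra.
  by apply: le_lt_trans s_eta; rewrite lee_fin; lra.
have sqs : Num.sqrt s < w.
  by rewrite -(ger0_norm (ltW w0)) -sqrtr_sqr ltr_sqrt // exprn_gt0.
have : B * Num.sqrt s <= B * w by rewrite ler_wpM2l // ltW.
by rewrite /merit_potential -/B; lra.
Qed.

End Desingularization.

(** * The normal map, its merit function and the linesearch *)

Section NormalMap.
Local Opaque prox gradient dotp enorm.
Context {R : realType} {n : nat}.
Context (f : 'cV[R]_n -> R) (phi : 'cV[R]_n -> \bar R) (lam L : R).
Context (f_diff : forall x, differentiable f x).
Context (phi_convex : econvex phi) (phi_lsc : lower_semicontinuous phi).
Context (phi_proper : eproper phi) (L_ge0 : 0 <= L).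
Context (grad_lipschitz : forall x y, edom phi x -> edom phi y ->
  enorm (gradient f x - gradient f y) <= L * enorm (x - y)).
Context (lam_gt0 : 0 < lam) (phi_subdiff : dom_subdiff phi !=set0).

Local Notation prx := (prox lam phi).
Local Notation F := (Fnor f phi lam).
Local Notation chi := (chi f phi lam).

Let sub z := prox_subdiff phi lam phi_convex phi_lsc phi_proper lam_gt0
  phi_subdiff z.
Let dom z : edom phi (prx z) := proj1 (sub z).
Let nonexp := prox_nonexpansive phi lam phi_convex phi_lsc phi_proper lam_gt0
  phi_subdiff.

Definition psi_prox (z : 'cV[R]_n) : R := f (prx z) + fine (phi (prx z)).

Lemma psi_proxE z : psi f phi (prx z) = (psi_prox z)%:E.
Proof. by rewrite /psi (edom_fin _ phi_proper _ (dom z)) -EFinD. Qed.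

Lemma meritE tau z :
  merit f phi lam tau z = (psi_prox z + tau * lam / 2 * chi z ^+ 2)%:E.
Proof. by rewrite /merit psi_proxE -EFinD. Qed.

Lemma chi_ge0 z : 0 <= chi z.
Proof. exact: enorm_ge0. Qed.

Lemma Fnor_in_subdiff_psi z : subdiff_psi f phi (prx z) (F z).
Proof. by exists (lam^-1 *: (z - prx z)) => //; exact: sub. Qed.

Lemma chi_lipschitz z w : chi w <= chi z + (L + 2 / lam) * enorm (w - z).
Proof.
have FE : F w = F z + (gradient f (prx w) - gradient f (prx z))
    + (lam^-1 *: (w - z) - lam^-1 *: (prx w - prx z)).
  rewrite /Fnor; move: (prx w) (prx z) => y x.
  by apply/colP => i; rewrite !mxE; ring.
rewrite /Defs.chi FE; apply: (le_trans (enormD _ _)).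
apply: (le_trans (lerD (enormD _ _) (enormD _ _))).
rewrite enormN !enormZ gtr0_norm ?invr_gt0 //.
have := grad_lipschitz _ _ (dom w) (dom z).
have h := nonexp z w; have := ler_wpM2l L_ge0 h.
have il0 : 0 <= lam^-1 by rewrite invr_ge0 ltW.
have := ler_wpM2l il0 h; lra.
Qed.

Lemma prox_upper z w :
  fine (phi (prx w)) - fine (phi (prx z))
  <= dotp (lam^-1 *: (w - prx w)) (prx w - prx z).
Proof.
have := subdiff_le _ phi_proper _ _ _ (sub w) (dom z).
by rewrite -(opprB (prx w) (prx z)) dotpNr; lra.
Qed.

Lemma taylor_prox z w :
  `|f (prx w) - f (prx z) - dotp (gradient f (prx z)) (prx w - prx z)|
  <= L * enorm (prx w - prx z) ^+ 2.
Proof. by apply: (taylor_le f f_diff phi) => //; exact: dom. Qed.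

(** Both functions are compared through their first-order expansions; the sum of
    the gradient and the proximal subgradient at the same point is [F w]. *)
Lemma psi_prox_le z w :
  psi_prox w - psi_prox z
  <= (chi w + 2 * L * enorm (w - z)) * enorm (w - z).
Proof.
have := prox_upper z w; have /ler_normlW := taylor_prox z w.
have := dotp_le (F w) (prx w - prx z).
have := dotp_ge (gradient f (prx w) - gradient f (prx z)) (prx w - prx z).
have := ler_wpM2l (chi_ge0 w) (nonexp z w).
have := grad_lipschitz _ _ (dom w) (dom z).
have := nonexp z w; rewrite -!/(chi w) /Fnor /psi_prox.
move: (chi w) => c; move: (prx w) (prx z) => y x.
move: (gradient f y) (gradient f x) => gy gx.
move: (lam^-1 *: (w - y)) (y - x) => g v.
rewrite !dotpDl dotpNl => vD lip h6 h1 h2 h3 h4.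
have h5 := ler_wpM2r (enorm_ge0 v) lip.
have h7 : L * enorm v ^+ 2 <= L * enorm (w - z) ^+ 2.
  by rewrite ler_wpM2l // ler_pXn2r ?nnegrE ?enorm_ge0.
lra.
Qed.

Lemma psi_prox_ge z w :
  psi_prox z + dotp (F z) (prx w - prx z) - L * enorm (prx w - prx z) ^+ 2
  <= psi_prox w.
Proof.
have := subdiff_le _ phi_proper _ _ _ (sub z) (dom w).
have := taylor_prox z w; rewrite ler_norml => /andP[+ _].
rewrite /Fnor /psi_prox; move: (prx w) (prx z) => y x.
move: (gradient f x) => gx; move: (lam^-1 *: (z - x)) (y - x) => g v.
by rewrite dotpDl; lra.
Qed.

Section Algorithm.
Context (P : params R) (P_adm : admissible P).

Local Notation tL := (trial_L f P).
Local Notation tnu := (trial_nu P).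
Local Notation ttau := (trial_tau f lam P).

Definition L_bound : R := Num.max (2 * L) (Lbar P).
Definition tau_low : R :=
  2 * gamma P * (1 - nu P) / (L_bound ^+ 2 * lam ^+ 2 + 2).

Lemma trial_L_bounds z w : 0 <= tL (prx z) (prx w) <= L_bound.
Proof.
rewrite /trial_L /L_bound; set V := enorm (prx w - prx z).
have [Lb0 _ _ _] := P_adm; case: ifPn => [V0|_]; last first.
  by rewrite ltW //= le_max lexx orbT.
have Vpos : 0 < V by rewrite lt_def V0 enorm_ge0.
apply/andP; split; 
  first by rewrite le_max [X in _ || X]divr_ge0 ?enorm_ge0 ?orbT.
rewrite le_max ge_max; apply/orP; left; apply/andP; split.
  rewrite ler_pdivrMr ?exprn_gt0 //; have /ler_normlW := taylor_prox z w.
  by rewrite -/V; lra.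
rewrite ler_pdivrMr // (le_trans (grad_lipschitz _ _ (dom w) (dom z))) //.
rewrite -/V; have := mulr_ge0 L_ge0 (ltW Vpos); lra.
Qed.

Lemma trial_L_descent z w :
  f (prx w) - f (prx z) - dotp (gradient f (prx z)) (prx w - prx z)
  <= tL (prx z) (prx w) / 2 * enorm (prx w - prx z) ^+ 2.
Proof.
rewrite /trial_L; set U := (_ - dotp _ _).
have [V0|V0] /= := eqVneq (enorm (prx w - prx z)) 0.
  have := taylor_prox z w; rewrite -/U V0 expr0n /= !mulr0.
  by move/ler_normlW.
have Vpos : 0 < enorm (prx w - prx z) by rewrite lt_def V0 enorm_ge0.
rewrite -ler_pdivrMr ?exprn_gt0 // ler_pdivlMr // le_max.
by apply/orP; left; rewrite mulrC mulrA.
Qed.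

Lemma trial_L_gradient z w :
  enorm (gradient f (prx w) - gradient f (prx z))
  <= tL (prx z) (prx w) * enorm (prx w - prx z).
Proof.
rewrite /trial_L; have [V0|V0] /= := eqVneq (enorm (prx w - prx z)) 0.
  by have := grad_lipschitz _ _ (dom w) (dom z); rewrite V0 !mulr0.
have Vpos : 0 < enorm (prx w - prx z) by rewrite lt_def V0 enorm_ge0.
by rewrite -ler_pdivrMr // le_max lexx orbT.
Qed.

Lemma trial_nu_bounds k (x y : 'cV[R]_n) : 0 <= tnu k x y <= nu P.
Proof.
have [_ _ [_ _ _ /andP[nu0 _]] _] := P_adm.
rewrite /trial_nu ge_min lexx andbT le_min ltW //=.
by rewrite mulr_ge0 ?sqr_ge0 ?powR_ge0.
Qed.

Lemma tau_low_gt0 : 0 < tau_low.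
Proof.
have [_ _ [_ _ /andP[g0 _] /andP[_ nu1]] _] := P_adm.
rewrite divr_gt0 ?mulr_gt0 ?subr_gt0 //.
by rewrite ltr_wpDl // mulr_ge0 ?sqr_ge0.
Qed.

Lemma trial_tau_le_prev k tp (x y : 'cV[R]_n) : ttau k tp x y <= tp.
Proof. by rewrite /trial_tau ge_min lexx orbT. Qed.

Lemma trial_tau_ge k tp z w :
  Num.min tau_low tp <= ttau k tp (prx z) (prx w).
Proof.
have [_ _ [_ _ /andP[g0 _] /andP[_ nu1]] _] := P_adm.
rewrite /trial_tau le_min !ge_min lexx orbT andbT; apply/orP; left.
have /andP[n0 n1] := trial_nu_bounds k (prx z) (prx w).
have /andP[l0 l1] := trial_L_bounds z w.
have ll : tL (prx z) (prx w) ^+ 2 * lam ^+ 2 <= L_bound ^+ 2 * lam ^+ 2.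
  by rewrite ler_wpM2r ?sqr_ge0 // ler_pXn2r // nnegrE (le_trans l0).
have den : 0 < tL (prx z) (prx w) ^+ 2 * lam ^+ 2 + 2.
  by rewrite ltr_wpDl // mulr_ge0 ?sqr_ge0.
have den' : 0 < L_bound ^+ 2 * lam ^+ 2 + 2 by lra.
apply: ler_pM.
- by rewrite !mulr_ge0 ?subr_ge0 // ltW.
- by rewrite invr_ge0 ltW.
- by rewrite ler_wpM2l ?mulr_ge0 ?(ltW g0) // lerD2l lerN2.
- by rewrite lef_pV2 ?posrE // lerD2r.
Qed.

(** The formula for [tau] is made for the last inequality, which is the
    hypothesis on [tau] in [merit_decrease_estimate]. *)
Lemma trial_tau_balance k tp z w : 0 < tp ->
  let l := tL (prx z) (prx w) in let nuk := tnu k (prx z) (prx w) in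
  let tau := ttau k tp (prx z) (prx w) in
  [/\ 0 < tau, tau <= 1 & tau * (l ^+ 2 * lam ^+ 2 + 2) <= 2 * (1 - nuk)].
Proof.
move=> tp0 l nuk tau.
have [_ _ [_ _ /andP[g0 g1] /andP[_ nu1]] _] := P_adm.
have tau0 : 0 < tau.
  by apply: lt_le_trans (trial_tau_ge _ _ _ _); rewrite lt_min tau_low_gt0.
have /andP[n0 n1] := trial_nu_bounds k (prx z) (prx w).
have ll : 0 <= l ^+ 2 * lam ^+ 2 by rewrite mulr_ge0 ?sqr_ge0.
have h : tau * (l ^+ 2 * lam ^+ 2 + 2) <= 2 * (1 - nuk).
  apply: (@le_trans _ _ (2 * gamma P * (1 - nuk))).
    by rewrite -ler_pdivlMr ?ltr_wpDl // /tau /trial_tau ge_min lexx.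
  by rewrite ler_wpM2r ?subr_ge0 ?(le_trans n1) ?(ltW nu1) //; lra.
split=> //; have := mulr_ge0 (ltW tau0) ll; rewrite /nuk in h; lra.
Qed.

(** The constant of [merit_decrease_estimate], with [X] bounding the residual and
    [E] the direction [e]. *)
Definition step_remainder (X E : R) : R :=
  let S := lam * (X + E) in
  let K1 := E + (L_bound + lam^-1) * S in
  2 * E * S + L_bound / 2 * S ^+ 2 + lam / 2 * X ^+ 2 + lam * X * E
    + lam / 2 * K1 ^+ 2.

Lemma ls_acceptE k tp z s al :
  ls_accept f phi lam P k tp z s al <->
  let tau := ttau k tp (prx z) (prx (z + s)) in
  psi_prox (z + s) + tau * lam / 2 * chi (z + s) ^+ 2
    - (psi_prox z + tau * lam / 2 * chi z ^+ 2)
  <= - (sigma P * lam * tau * al / 2) * chi z ^+ 2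
     - tnu k (prx z) (prx (z + s)) / (lam * al)
       * enorm (prx (z + s) - prx z) ^+ 2.
Proof. by rewrite /ls_accept !meritE -EFinB lee_fin. Qed.

(** The estimate yields a decrease with factor [1 / 2] where the acceptance test
    asks for [sigma / 2]; the difference absorbs the quadratic remainder of a
    short step. *)
Lemma small_step_accepted k tp z e al c X E :
  0 < tp -> 0 < al <= 1 -> 0 <= c -> c <= chi z -> chi z <= X ->
  enorm e <= E ->
  al * step_remainder X E
    <= (1 - sigma P) / 2 * Num.min tau_low tp * lam * c ^+ 2 ->
  ls_accept f phi lam P k tp z ((al * lam) *: (- F z + al *: e)) al.
Proof.
move=> tp0 al01 c0 cz zX eE small; apply/ls_acceptE => /=.
set s := _ *: (- F z + _); set w := z + s.
have [_ _ [/andP[s0 s1] _ _ _] _] := P_adm.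
have := trial_tau_balance k tp z w tp0 => /= -[].
have := trial_tau_ge k tp z w; have lL := trial_L_bounds z w.
move: (ttau k tp (prx z) (prx w)) (tnu k (prx z) (prx w)) => tau nuk.
move=> tau_ge tau0 tau1 tau_bal.
set G := gradient f (prx w) - gradient f (prx z).
have FwE : F w = F z + G + lam^-1 *: (s - (prx w - prx z)).
  rewrite /G /Fnor {2}/w; move: (prx w) (prx z) => y x.
  by apply/colP => i; rewrite !mxE; ring.
have ws : w - z = s by rewrite /w addrC addKr.
have firm := prox_firmly_nonexpansive phi lam phi_convex phi_lsc phi_proper
  lam_gt0 phi_subdiff z w; rewrite ws in firm.
have nonex := nonexp z w; rewrite ws in nonex.
have psid : psi_prox w - psi_prox z
   <= dotp (F z) (prx w - prx z) + lam^-1 * dotp s (prx w - prx z)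
      - lam^-1 * enorm (prx w - prx z) ^+ 2
      + tL (prx z) (prx w) / 2 * enorm (prx w - prx z) ^+ 2.
  have := prox_upper z w; have := trial_L_descent z w.
  have -> : w - prx w = (z - prx z) + s - (prx w - prx z).
    rewrite {1}/w; move: (prx w) (prx z) => y x.
    by apply/colP => i; rewrite !mxE; ring.
  move: (tL (prx z) (prx w)) => l; rewrite /psi_prox /Fnor.
  move: (prx w) (prx z) => y x; move: (gradient f x) => gx.
  move: (y - x) (z - x) => v u.
  rewrite enorm_sqr !dotpE; lra.
have al0 : 0 < al by case/andP: al01.
have est : psi_prox w - psi_prox z + tau * lam / 2 * (chi w ^+ 2 - chi z ^+ 2)
    <= - (tau * lam * al / 2 * chi z ^+ 2)
       - nuk / (lam * al) * enorm (prx w - prx z) ^+ 2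
       + al ^+ 2 * step_remainder X E.
  rewrite /Defs.chi FwE.
  apply: (@merit_decrease_estimate _ _ _ e _ _ s _ _ _ _
    (tL (prx z) (prx w))) => //; first by rewrite tau0.
  exact: trial_L_gradient.
have small_tau : al ^+ 2 * step_remainder X E
    <= al * ((1 - sigma P) / 2 * (tau * lam * chi z ^+ 2)).
  have lam0 := ltW lam_gt0; have sg : 0 <= (1 - sigma P) / 2.
    by rewrite divr_ge0 // subr_ge0 ltW.
  have m0 : 0 <= Num.min tau_low tp.
    by rewrite le_min (ltW tp0) (ltW tau_low_gt0).
  rewrite expr2 -mulrA ler_pM2l // (le_trans small) // -2!mulrA ler_wpM2l //.
  rewrite mulrA; apply: ler_pM; rewrite ?sqr_ge0 ?mulr_ge0 //.
    by rewrite ler_wpM2r.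
  by rewrite ler_pXn2r ?nnegrE ?chi_ge0.
clear psid FwE firm nonex.
move: (psi_prox w) (psi_prox z) (chi w) (chi z) (step_remainder X E)
  (enorm (prx w - prx z)) est small_tau => pw pz cw cz0 r V est small_tau.
lra.
Qed.

(** The two kinds of step have one shape, since the first-order step is the case
    [e = 0]. *)
Lemma iteration_linesearch k B eps tp z tau z' :
  iteration f phi lam P k B eps tp z tau z' ->
  exists e t, let s al := (al * lam) *: (- F z + al *: e) in
    [/\ Num.min (b_seq P k * chi z `^ expq P) (eta P) * enorm e <= chi z,
        ls_accept f phi lam P k tp z (s (rho P ^+ t)) (rho P ^+ t),
        forall j, (j < t)%N ->
          ~ ls_accept f phi lam P k tp z (s (rho P ^+ j)) (rho P ^+ j),
        tau = ttau k tp (prx z) (prx z') & z' = z + s (rho P ^+ t)].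
Proof.
move=> [D [q [t [_ _]]]] /=; rewrite /trial_shift.
case: ifPn => [test|_] [acc rej] -> ->.
  by exists (lam^-1 *: q - (B *m D + lam^-1 *: (1%:M - D)) *m q), t; split.
exists 0, t; split.
- by rewrite enorm0 mulr0 chi_ge0.
- by rewrite scaler0 addr0.
- by move=> j jt; rewrite scaler0 addr0; exact: rej.
- by [].
- by rewrite scaler0 addr0.
Qed.

Lemma L_bound_gt0 : 0 < L_bound.
Proof. by have [Lb0 _ _ _] := P_adm; rewrite lt_max Lb0 orbT. Qed.

Lemma step_remainder_ge0 X E : 0 <= X -> 0 <= E -> 0 <= step_remainder X E.
Proof.
move=> X0 E0; have lam0 := ltW lam_gt0; have Lb0 := ltW L_bound_gt0.
have il0 : 0 <= lam^-1 by rewrite invr_ge0.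
rewrite /step_remainder; set S := lam * (X + E).
have S0 : 0 <= S by rewrite mulr_ge0 // addr_ge0.
have K0 : 0 <= E + (L_bound + lam^-1) * S.
  by rewrite addr_ge0 // mulr_ge0 // addr_ge0.
move: (E + _) => K1 in K0 *; clearbody S.
do 4?apply: addr_ge0; rewrite ?mulr_ge0 ?sqr_ge0 ?divr_ge0 //.
Qed.

(** * The iterates of an algorithm that does not terminate *)

Section Sequence.
Context (B : nat -> 'M[R]_n) (eps : nat -> R) (z : nat -> 'cV[R]_n).
Context (tau : nat -> R) (zbar : 'cV[R]_n).
Context (tau0 : tau 0%N = tau_init P) (running : forall k, F (z k) != 0).
Context (steps : forall k,
  iteration f phi lam P k (B k) (eps k) (tau k) (z k) (tau k.+1) (z k.+1)).
Context (zbar_near : forall (r : R) N, 0 < r ->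
  exists2 k, (N <= k)%N & enorm (z k - zbar) < r).

Local Notation c k := (chi (z k)).
Local Notation V k := (enorm (prx (z k.+1) - prx (z k))).

Definition tau_min : R := Num.min tau_low (tau_init P).

Lemma tau_min_gt0 : 0 < tau_min.
Proof. by have [_ ti0 _ _] := P_adm; rewrite lt_min tau_low_gt0. Qed.

Lemma tau_nonincreasing k : tau k.+1 <= tau k.
Proof.
by have [e [t [_ _ _ -> _]]] := iteration_linesearch _ _ _ _ _ _ _ (steps k);
  exact: trial_tau_le_prev.
Qed.

Lemma tau_ge k : tau_min <= tau k.
Proof.
elim: k => [|k IH]; first by rewrite tau0 /tau_min ge_min lexx orbT.
have [e [t [_ _ _ -> _]]] := iteration_linesearch _ _ _ _ _ _ _ (steps k).
apply: le_trans (trial_tau_ge _ _ _ _); rewrite le_min IH andbT.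
by rewrite /tau_min ge_min lexx.
Qed.

Lemma tau_le k : tau k <= tau_init P.
Proof.
by elim: k => [|k]; [rewrite tau0|apply: le_trans; exact: tau_nonincreasing].
Qed.

Lemma chi_gt0 k : 0 < c k.
Proof. by rewrite lt_def chi_ge0 andbT enorm_eq0 running. Qed.

Definition merit_value k : R := psi_prox (z k) + tau k * lam / 2 * c k ^+ 2.

(** The last clause bounds the accepted step size from below: if every step size
    up to [abar] would pass the test, then backtracking stops at the latest one
    reduction below [abar]. *)
Lemma merit_step k : exists al,
  [/\ 0 < al <= 1,
      merit_value k.+1 <= merit_value k
        - (sigma P * lam * tau_min / 2 * al * c k ^+ 2
           + tnu k (prx (z k)) (prx (z k.+1)) / lam * (V k ^+ 2 / al))
    & forall c0 X E e0 abar, 0 <= c0 -> c0 <= c k -> c k <= X ->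
        0 < e0 -> e0 <= Num.min (b_seq P k * c k `^ expq P) (eta P) ->
        X <= e0 * E -> 0 <= E -> 0 < abar <= 1 ->
        abar * step_remainder X E
          <= (1 - sigma P) / 2 * tau_min * lam * c0 ^+ 2 ->
        rho P * abar <= al].
Proof.
have [_ _ [/andP[s0 s1] /andP[rho0 rho1] _ _] _] := P_adm.
have [e [t [e_le acc rej tauE zE]]] :=
  iteration_linesearch _ _ _ _ _ _ _ (steps k).
have al0 : 0 < rho P ^+ t by rewrite exprn_gt0.
exists (rho P ^+ t); split.
- by rewrite al0 exprn_ile1 // ltW.
- move/ls_acceptE: acc; rewrite -zE -tauE /merit_value.
  have := ler_wpM2r (sqr_ge0 (c k)) (tau_nonincreasing k).
  have := ler_wpM2r (sqr_ge0 (c k)) (tau_ge k.+1).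
  have cc := sqr_ge0 (c k).
  have lam0 := lam_gt0.
  move: (tnu k _ _) (V k) => nuk v.
  move: (psi_prox (z k.+1)) (psi_prox (z k)) => p1 p0.
  move: (c k.+1) (c k) cc => c1 ck cc.
  move: (tau k.+1) (tau k) tau_min => t1 tk tm.
  move: (rho P ^+ t) al0 => al al0 tm_le t_le acc.
  have -> : nuk / lam * (v ^+ 2 / al) = nuk / (lam * al) * v ^+ 2.
    by field; rewrite !gt_eqF.
  have h1 : lam / 2 * (t1 * ck ^+ 2) <= lam / 2 * (tk * ck ^+ 2).
    by rewrite ler_wpM2l // divr_ge0 // ltW.
  have h2 : sigma P * lam / 2 * al * (tm * ck ^+ 2)
      <= sigma P * lam / 2 * al * (t1 * ck ^+ 2).
    by rewrite ler_wpM2l // !mulr_ge0 // ltW.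
  by lra.
move=> c0 X E e0 abar c00 c0c cX e00 e0_le XE E0 /andP[ab0 ab1] small.
have X0 : 0 <= X := le_trans c00 (le_trans c0c cX).
have eE : enorm e <= E.
  rewrite -(ler_pM2l e00) (le_trans _ XE) // (le_trans _ cX) //.
  by apply: le_trans e_le; rewrite ler_wpM2r ?enorm_ge0.
case: t {acc zE tauE} al0 rej => [|s] al0 rej.
  by rewrite expr0 mulr_ile1 // ltW.
rewrite exprS ler_pM2l // leNgt; apply/negP => lt_ab.
apply: (rej s (ltnSn s)).
have tk0 : 0 < tau k := lt_le_trans tau_min_gt0 (tau_ge k).
apply: (@small_step_accepted k (tau k) (z k) e _ c0 X E) => //.
  by rewrite exprn_gt0 //= exprn_ile1 // ltW.
apply: (@le_trans _ _ (abar * step_remainder X E)).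
  by rewrite ler_wpM2r ?step_remainder_ge0 // ltW.
apply: (le_trans small); rewrite ler_wpM2r ?sqr_ge0 // ler_wpM2r ?(ltW lam_gt0) //.
rewrite ler_wpM2l ?divr_ge0 ?subr_ge0 ?(ltW s1) // le_min.
by rewrite tau_ge andbT /tau_min ge_min lexx.
Qed.

Lemma merit_nonincreasing k : merit_value k.+1 <= merit_value k.
Proof.
have [_ _ [/andP[s0 _] _ _ _] _] := P_adm.
have [al [/andP[al0 _] h _]] := merit_step k; apply: (le_trans h).
have /andP[n0 _] := trial_nu_bounds k (prx (z k)) (prx (z k.+1)).
have [lam0 tm0 s0' al0'] :
    [/\ 0 <= lam, 0 <= tau_min, 0 <= sigma P & 0 <= al].
  by split; apply: ltW => //; exact: tau_min_gt0.
rewrite lerBlDr lerDl; apply: addr_ge0.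
  by rewrite mulr_ge0 ?sqr_ge0 // mulr_ge0 // divr_ge0 // mulr_ge0 // mulr_ge0.
by rewrite mulr_ge0 // divr_ge0 // sqr_ge0.
Qed.

(** If [zbar] were not stationary, then near [zbar] the residual and hence the
    step sizes would be bounded below, so the merit value would drop by a fixed
    amount at each of the infinitely many visits, while staying bounded there. *)
Lemma limit_stationary : chi zbar = 0.
Proof.
have [_ _ [/andP[s0 s1] /andP[rho0 rho1] _ _] [q0 _ eta0]] := P_adm.
apply/eqP; rewrite eq_le chi_ge0 andbT leNgt; apply/negP => C0.
set C := chi zbar in C0.
pose K := L + 2 / lam; have K0 : 0 < K.
  by rewrite ltr_wpDl // divr_gt0.
pose r := C / (2 * K); have r0 : 0 < r by rewrite divr_gt0 // mulr_gt0.
have Kr : K * r = C / 2.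
  by rewrite /r; field; rewrite gt_eqF.
pose c0 := C / 2; pose X := 2 * C.
have c00 : 0 < c0 by rewrite divr_gt0.
have near k : enorm (z k - zbar) < r -> c0 <= c k <= X.
  move=> zk; have := chi_lipschitz zbar (z k).
  have := chi_lipschitz (z k) zbar; rewrite [enorm (zbar - _)]enormB -/C -/K.
  have : K * enorm (z k - zbar) < K * r by rewrite ltr_pM2l.
  rewrite Kr /c0 /X; move: (K * _) (c k) => *; lra.
pose e0 := Num.min (b_seq P 1 * c0 `^ expq P) (eta P).
have e00 : 0 < e0.
  have /andP[b1 _] := b_seq_ge P 1 P_adm (ltnSn 0).
  by rewrite lt_min eta0 andbT mulr_gt0 // powR_gt0.
clearbody c0.
pose E := X / e0; have X0 : 0 < X by rewrite mulr_gt0.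
have E0 : 0 <= E by rewrite divr_ge0 ?ltW.
have rem0 := step_remainder_ge0 _ _ (ltW X0) E0.
pose A := (1 - sigma P) / 2 * tau_min * lam * c0 ^+ 2.
have A0 : 0 < A.
  rewrite mulr_gt0 ?exprn_gt0 // mulr_gt0 // mulr_gt0 ?tau_min_gt0 //.
  by rewrite divr_gt0 // subr_gt0.
pose abar := Num.min 1 (A / (step_remainder X E + 1)).
have rem1 : 0 < step_remainder X E + 1 by rewrite ltr_wpDl.
have ab0 : 0 < abar by rewrite lt_min ltr01 divr_gt0.
have ab1 : abar <= 1 by rewrite ge_min lexx.
have ab_small : abar * step_remainder X E <= A.
  apply: (@le_trans _ _ (abar * (step_remainder X E + 1))).
    by rewrite ler_pM2l // lerDl.
  by rewrite -ler_pdivlMr // ge_min lexx orbT.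
pose drop := sigma P * lam * tau_min / 2 * (rho P * abar) * c0 ^+ 2.
have drop0 : 0 < drop.
  rewrite mulr_gt0 ?exprn_gt0 // mulr_gt0 //; last by rewrite mulr_gt0.
  by rewrite divr_gt0 // mulr_gt0 ?tau_min_gt0 // mulr_gt0.
apply: (@nonincreasing_no_repeated_drop R merit_value
  (psi_prox zbar - (C + 2 * L * r) * r) drop drop0 merit_nonincreasing) => N.
have [k Nk zk] := zbar_near _ N.+1 r0.
have /andP[c_ge c_le] := near _ zk.
exists k; split; first exact: ltnW.
- have [al [/andP[al0 _] h_le al_ge]] := merit_step k.
  have al_ge' : rho P * abar <= al.
    apply: (al_ge c0 X E e0) => //; try exact: ltW.
    + have k0 : (0 < k)%N by apply: leq_trans Nk.
      have /andP[b0 b_le] := b_seq_ge P k P_adm k0.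
      rewrite le_min ge_min (ge_min (eta P)) lexx orbT andbT; apply/orP; left.
      rewrite ler_pM ?powR_ge0 ?(ltW b0) //.
      by apply: ge0_ler_powR; rewrite ?nnegrE ?(ltW q0) ?(ltW c00) ?chi_ge0.
    + by rewrite /E mulrC divfK // gt_eqF.
    + by rewrite ab0.
  apply: (le_trans h_le); rewrite lerD2l lerN2.
  have /andP[n0 _] := trial_nu_bounds k (prx (z k)) (prx (z k.+1)).
  rewrite -[drop]addr0 lerD //; last first.
    by rewrite mulr_ge0 ?divr_ge0 ?sqr_ge0 ?(ltW lam_gt0) ?(ltW al0).
  have sl0 : 0 <= sigma P * lam * tau_min / 2.
    by rewrite divr_ge0 // ltW // mulr_gt0 ?tau_min_gt0 // mulr_gt0.
  rewrite /drop; apply: ler_pM.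
  - by rewrite mulr_ge0 // mulr_ge0 // ltW.
  - exact: sqr_ge0.
  - by rewrite ler_wpM2l.
  - by rewrite ler_pXn2r ?nnegrE ?chi_ge0 // ltW.
have := psi_prox_le (z k) zbar; rewrite [enorm (zbar - _)]enormB -/C.
have D0 := enorm_ge0 (z k - zbar).
have h1 : (C + 2 * L * enorm (z k - zbar)) * enorm (z k - zbar)
    <= (C + 2 * L * r) * r.
  have L2 : 0 <= 2 * L by rewrite mulr_ge0.
  apply: ler_pM => //; last exact: ltW.
    by rewrite addr_ge0 ?(ltW C0) // mulr_ge0.
  by rewrite lerD2l ler_wpM2l // ltW.
have h2 : 0 <= tau k * lam / 2 * c k ^+ 2.
  rewrite mulr_ge0 ?sqr_ge0 // divr_ge0 // mulr_ge0 ?(ltW lam_gt0) //.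
  exact: ltW (lt_le_trans tau_min_gt0 (tau_ge k)).
rewrite /merit_value; move: h1 h2.
move: (_ * enorm _) (_ * r) (tau k * _ / _ * _) => a b d.
by move: (psi_prox (z k)) (psi_prox zbar) => p q; lra.
Qed.

Lemma limit_Fnor : F zbar = 0.
Proof. by apply/eqP; rewrite -enorm_eq0; apply/eqP; exact: limit_stationary. Qed.

Local Notation excess k := (merit_value k - psi_prox zbar).

Lemma merit_mono i j : (i <= j)%N -> merit_value j <= merit_value i.
Proof.
move=> /subnK <-; elim: (j - i)%N => [|d IH]; first by rewrite add0n.
by rewrite addSn (le_trans (merit_nonincreasing _)).
Qed.

Lemma psi_prox_le_merit k : psi_prox (z k) <= merit_value k.
Proof.
rewrite /merit_value lerDl mulr_ge0 ?sqr_ge0 // divr_ge0 // mulr_ge0 ?(ltW lam_gt0) //.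
exact: ltW (lt_le_trans tau_min_gt0 (tau_ge k)).
Qed.

Lemma merit_excess_ge0 k : 0 <= excess k.
Proof.
rewrite leNgt; apply/negP => neg.
have g0 : 0 < - excess k by rewrite oppr_gt0.
have [r r0 rP] := quadratic_small _ _ L_ge0 g0.
have [m km zm] := zbar_near _ k r0.
have := merit_mono _ _ km; have := psi_prox_le_merit m.
have := psi_prox_ge zbar (z m); rewrite limit_Fnor dotp0l.
have V_le := nonexp zbar (z m).
have := rP _ (enorm_ge0 _) (le_lt_trans V_le zm).
move: (enorm _) (merit_value m) (psi_prox (z m)) => v M w.
move: (merit_value k) (psi_prox zbar) => Mk wb; lra.
Qed.

Lemma merit_excess_gt0 k : 0 < excess k.
Proof.
have [_ _ [/andP[s0 _] _ _ _] _] := P_adm.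
have := merit_excess_ge0 k.+1.
have [al [/andP[al0 _] h_le _]] := merit_step k.
have /andP[n0 _] := trial_nu_bounds k (prx (z k)) (prx (z k.+1)).
have d1 : 0 < sigma P * lam * tau_min / 2 * al * c k ^+ 2.
  rewrite mulr_gt0 ?exprn_gt0 ?chi_gt0 // mulr_gt0 // divr_gt0 //.
  by rewrite mulr_gt0 ?tau_min_gt0 // mulr_gt0.
have d2 : 0 <= tnu k (prx (z k)) (prx (z k.+1)) / lam * (V k ^+ 2 / al).
  by rewrite mulr_ge0 ?divr_ge0 ?sqr_ge0 // ltW.
move: h_le d1 d2; move: (_ * c k ^+ 2) (_ * (_ / al)) => d1 d2.
move: (merit_value k) (merit_value k.+1) (psi_prox zbar) => a b w; lra.
Qed.

Lemma merit_excess_small (e : R) : 0 < e ->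
  exists N, forall k, (N <= k)%N -> excess k < e.
Proof.
move=> e0; pose K := L + 2 / lam.
have K0 : 0 <= K by rewrite addr_ge0 // divr_ge0 // ltW.
have ti0 : 0 < tau_init P by have [] := P_adm.
pose M := K + 2 * L + tau_init P * lam / 2 * K ^+ 2.
have M0 : 0 <= M.
  apply: addr_ge0; first by rewrite addr_ge0 // mulr_ge0.
  by rewrite mulr_ge0 ?sqr_ge0 // divr_ge0 // mulr_ge0 // ltW.
have [r r0 rP] := quadratic_small _ _ M0 e0.
have [N _ zN] := zbar_near _ 0 r0.
exists N => k Nk; apply: le_lt_trans (rP _ (enorm_ge0 _) zN).
apply: (@le_trans _ _ (excess N)); first by rewrite lerD2r merit_mono.
set d := enorm (z N - zbar); have d0 : 0 <= d := enorm_ge0 _.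
have c_le : c N <= K * d.
  by have := chi_lipschitz zbar (z N); rewrite limit_stationary add0r.
have c2 : c N ^+ 2 <= K ^+ 2 * d ^+ 2.
  by rewrite -exprMn ler_pXn2r ?nnegrE ?chi_ge0 ?mulr_ge0.
have h1 := psi_prox_le zbar (z N).
have h2 : (c N + 2 * L * d) * d <= (K * d + 2 * L * d) * d.
  by rewrite ler_wpM2r // lerD2r.
have h3 : tau N * lam / 2 * c N ^+ 2
    <= tau_init P * lam / 2 * (K ^+ 2 * d ^+ 2).
  apply: ler_pM => //.
  - rewrite divr_ge0 // mulr_ge0 ?(ltW lam_gt0) //.
    exact: ltW (lt_le_trans tau_min_gt0 (tau_ge N)).
  - exact: sqr_ge0.
  - by rewrite ler_wpM2r // ler_wpM2r ?tau_le // ltW.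
rewrite /merit_value /M; rewrite -/d in h1.
move: h1 h2 h3; move: (tau N * lam / 2 * _) => X.
move: (psi_prox _) (psi_prox _) ((c N + _) * d) => p q Y; clearbody K d; lra.
Qed.

Section KurdykaLojasiewicz.
Context (KL_xbar : KL_property f phi (prx zbar)).

(** [F w] is one of the subgradients of the objective at [prox w], so the residual
    bounds the distance of [0] from all of them. *)
Lemma KL_residual : exists (eta : \bar R) (h : R -> R) (r : R),
  [/\ (0 < eta)%E, desingularizing eta h, 0 < r &
    forall w, enorm (prx w - prx zbar) < r ->
      0 < psi_prox w - psi_prox zbar ->
      ((psi_prox w - psi_prox zbar)%:E < eta)%E ->
      1 <= derive1 h (psi_prox w - psi_prox zbar) * chi w].
Proof.
have [_ [eta [h [eta0 h_des /nbhs_enormP[r r0 rP]]]]] := KL_xbar.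
exists eta, h, r; split=> // w wr D0 D_eta.
have := rP _ wr; rewrite !psi_proxE -EFinB lte_fin D0 D_eta => /(_ isT) /= kl.
have [_ _ _ _ h_der] := h_des; have [_ _ h'0] := h_der _ D0 D_eta.
rewrite -lee_fin EFinM; apply: (le_trans kl).
apply: lee_wpmul2l; first by rewrite lee_fin ltW.
by apply: ereal_inf_lbound; exists (F w) => //; exact: Fnor_in_subdiff_psi.
Qed.

(** Either [nu_k] is the cap [nu] and the merit decrease controls the step length
    through the KL inequality, or the step is shorter than the reciprocal of
    [log_weight k]. [Psi] adds up the two potentials. *)
Lemma prox_path_controlled : exists (Psi : nat -> R) (r : R) (N0 : nat),
  [/\ 0 < r, forall k, (N0 <= k)%N -> 0 <= Psi k,
      forall e : R, 0 < e -> exists N, forall k, (N <= k)%N -> Psi k < e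
    & forall k, (N0 <= k)%N -> enorm (prx (z k) - prx zbar) < r ->
        V k <= Psi k - Psi k.+1].
Proof.
have [_ ti0 [/andP[s0 _] _ _ /andP[nu0 _]] _] := P_adm.
have [eta [h [r [eta0 h_des r0 kl]]]] := KL_residual.
have [e0 e00 e0_eta] : exists2 e0 : R, 0 < e0 & (e0%:E <= eta)%E.
  case: eta eta0 {h_des kl} => [t||] //; first by rewrite lte_fin; exists t.
  by exists 1 => //; exact: leey.
have [N1 N1P] := merit_excess_small _ e00.
pose A0 := tau_init P * lam / 2.
pose m := Num.min (sigma P * lam * tau_min / 2) (nu P / lam).
have m0 : 0 < m.
  rewrite lt_min !divr_gt0 // mulr_gt0 ?tau_min_gt0 // mulr_gt0 //.
pose Phi k := merit_potential h A0 (excess k).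
have ex_eta k : (N1 <= k)%N -> ((excess k)%:E < eta)%E.
  by move=> N1k; apply: lt_le_trans e0_eta; rewrite lte_fin N1P.
pose Psi k := (2 * m)^-1 * Phi k + 2 / ln k%:R.
exists Psi, r, (maxn N1 2); split=> //.
- move=> k; rewrite geq_max => /andP[N1k k2].
  rewrite addr_ge0 ?divr_ge0 ?ln_ge0 ?ler1n ?(ltnW k2) //.
  rewrite mulr_ge0 ?invr_ge0 ?mulr_ge0 ?(ltW m0) //.
  by apply: merit_potential_ge0 h_des _ _; [exact: merit_excess_ge0|exact: ex_eta].
- move=> e e_gt0; have em : 0 < m * e by rewrite mulr_gt0.
  have [d d0 dP] := merit_potential_small _ _ A0 _ h_des eta0 em.
  have [N2 N2P] := merit_excess_small _ d0.
  have e2 : 0 < e / 2 by rewrite divr_gt0.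
  have [N3 N3P] := inv_ln_small _ e2.
  exists (maxn N1 (maxn N2 N3)) => k; rewrite !geq_max => /and3P[N1k N2k N3k].
  have := N3P _ N3k; have : Phi k < m * e.
    by apply: dP; rewrite ?merit_excess_ge0 ?N2P // ex_eta.
  rewrite /Psi; move: (Phi k) (2 / ln _) => p l pm le2.
  have : (2 * m)^-1 * p < e / 2.
    by rewrite mulrC ltr_pdivrMr ?mulr_gt0 //; lra.
  by lra.
move=> k; rewrite geq_max => /andP[N1k k2] xr.
have c0 := chi_gt0 k; have d0 := merit_excess_gt0 k.
have ex' : 0 <= excess k.+1 <= excess k.
  by rewrite merit_excess_ge0 lerD2r merit_nonincreasing.
have A_le : 0 <= tau k * lam / 2 <= A0.
  rewrite /A0 !(ler_wpM2r, divr_ge0, mulr_ge0) ?tau_le ?(ltW lam_gt0) ?invr_ge0 //.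
  exact: ltW (lt_le_trans tau_min_gt0 (tau_ge k)).
have exE : excess k = (psi_prox (z k) - psi_prox zbar)
    + tau k * lam / 2 * c k ^+ 2 by rewrite /merit_value; ring.
have phi_dec : excess k - excess k.+1 <= c k * (Phi k - Phi k.+1).
  apply: (merit_potential_decrease _ _ _ _ _ _ _ _ h_des d0 (ex_eta _ N1k) ex'
    (ltW c0) exE A_le) => D0 D_eta.
  exact: kl.
have phi_mono : Phi k.+1 <= Phi k.
  rewrite -subr_ge0 -(pmulr_rge0 _ c0); apply: le_trans phi_dec.
  by rewrite subr_ge0; case/andP: ex'.
have log_dec := @inv_log_weight_le R k k2.
have w0 : 0 <= (log_weight k : R)^-1.
  by rewrite invr_ge0 mulr_ge0 ?sqr_ge0.
have im0 : 0 < (2 * m)^-1 by rewrite invr_gt0 mulr_gt0.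
have pot : 0 <= (2 * m)^-1 * (Phi k - Phi k.+1).
  by rewrite mulr_ge0 ?subr_ge0 // ltW.
have PsiE : Psi k - Psi k.+1 = (2 * m)^-1 * (Phi k - Phi k.+1)
    + (2 / ln k%:R - 2 / ln k.+1%:R).
  rewrite /Psi; move: (2 * m)^-1 (Phi k) (Phi k.+1) => i p p'.
  by move: (2 / ln k%:R) (2 / ln k.+1%:R) => l l'; ring.
rewrite PsiE.
have [nuE|V_small] := trial_nu_alt P k (prx (z k)) (prx (z k.+1)) P_adm
    (ltnW k2); last first.
  by rewrite -[leLHS]add0r lerD // (le_trans V_small).
rewrite -[leLHS]addr0 lerD // ?(le_trans w0) //.
have [al [/andP[al0 _] h_le _]] := merit_step k.
rewrite nuE in h_le.
have dec : sigma P * lam * tau_min / 2 * al * c k ^+ 2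
    + nu P / lam * (V k ^+ 2 / al) <= excess k - excess k.+1.
  move: h_le; move: (_ * c k ^+ 2 + _) => d.
  move: (merit_value k) (merit_value k.+1) (psi_prox zbar) => u v w h_le.
  by rewrite opprB addrA subrK lerBrDl -lerBrDr.
apply: (step_le_potential _ _ _ _ _ _ _ _ _ _ m0 al0 c0 _ _ dec phi_dec).
  by rewrite ge_min lexx.
by rewrite ge_min lexx orbT.
Qed.

Lemma prox_near (e : R) N : 0 < e ->
  exists2 k, (N <= k)%N & enorm (prx (z k) - prx zbar) < e.
Proof.
move=> e0; have [k Nk zk] := zbar_near _ N e0.
by exists k => //; exact: le_lt_trans (nonexp _ _) zk.
Qed.

Lemma prox_path_finite : (\sum_(0 <= k <oo) (V k)%:E < +oo)%E.
Proof.
have [Psi [r [N0 [r0 Psi0 Psi_small ctrl]]]] := prox_path_controlled.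
have [N N0N stepN] := path_eventually_controlled (fun k => prx (z k))
  (prx zbar) Psi r N0 r0 Psi0 Psi_small prox_near ctrl.
apply: (nneseries_lt_pinfty _ N (Psi N)) => [k|k Nk]; first exact: enorm_ge0.
apply: (le_trans (telescoping_bound _ Psi N k stepN Nk)).
by rewrite gerBl Psi0 // (leq_trans N0N).
Qed.

Lemma prox_cvg (e : R) : 0 < e ->
  exists N, forall k, (N <= k)%N -> enorm (prx (z k) - prx zbar) < e.
Proof.
have [Psi [r [N0 [r0 Psi0 Psi_small ctrl]]]] := prox_path_controlled.
exact: (controlled_path_cvg (fun k => prx (z k)) (prx zbar) Psi r N0 r0 Psi0
  Psi_small prox_near ctrl).
Qed.

(** The merit values tend to the objective at the limit, and the subgradient
    inequality there bounds the objective values from below by quantities with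
    the same limit; the squared residuals are what remains. *)
Lemma chi_cvg0 (e : R) : 0 < e ->
  exists N, forall k, (N <= k)%N -> c k < e.
Proof.
move=> e0; pose w := tau_min * lam / 2 * e ^+ 2 / 2.
have w0 : 0 < w.
  rewrite divr_gt0 // mulr_gt0 ?exprn_gt0 // divr_gt0 //.
  by rewrite mulr_gt0 ?tau_min_gt0.
have [r r0 rP] := quadratic_small _ _ L_ge0 w0.
have [N1 N1P] := merit_excess_small _ w0; have [N2 N2P] := prox_cvg _ r0.
exists (maxn N1 N2) => k; rewrite geq_max => /andP[N1k N2k].
have tl0 : 0 < tau_min * lam / 2.
  by rewrite divr_gt0 // mulr_gt0 ?tau_min_gt0.
rewrite -(@ltr_pXn2r _ 2) ?nnegrE ?chi_ge0 ?(ltW e0) // -(ltr_pM2l tl0).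
have tm : tau_min * lam / 2 * c k ^+ 2 <= tau k * lam / 2 * c k ^+ 2.
  rewrite ler_wpM2r ?sqr_ge0 // ler_wpM2r // ler_wpM2r ?(ltW lam_gt0) //.
  exact: tau_ge.
apply: (le_lt_trans tm).
have := N1P _ N1k; rewrite /merit_value.
have := psi_prox_ge zbar (z k); rewrite limit_Fnor dotp0l.
have := rP _ (enorm_ge0 _) (N2P _ N2k).
have -> : tau_min * lam / 2 * e ^+ 2 = w + w by rewrite /w -splitr.
clearbody w.
move: (tau k * _ / _ * _) (L * _) (psi_prox _) (psi_prox _) => x y p q.
move: w {w0 rP N1P N2P tm tl0} => u; lra.
Qed.

(** [z_k] is recovered from [x_k] and the residual:
    [z = x - lam * gradient f x + lam * F z]. *)
Lemma iterates_cvg (e : R) : 0 < e ->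
  exists N, forall k, (N <= k)%N -> enorm (z k - zbar) < e.
Proof.
move=> e0; have lam0 := ltW lam_gt0.
have M0 : 0 < 1 + lam * L by rewrite ltr_wpDr // mulr_ge0.
have e1 : 0 < e / 2 / (1 + lam * L) by rewrite !divr_gt0.
have e2 : 0 < e / 2 / lam by rewrite !divr_gt0.
have [N1 N1P] := prox_cvg _ e1; have [N2 N2P] := chi_cvg0 _ e2.
exists (maxn N1 N2) => k; rewrite geq_max => /andP[N1k N2k].
have zE w : w = prx w + lam *: (F w - gradient f (prx w)).
  rewrite /Fnor; move: (prx w) => x; move: (gradient f x) => g.
  by apply/colP => i; rewrite !mxE; field; rewrite gt_eqF.
have -> : z k - zbar = (prx (z k) - prx zbar)
    + lam *: (F (z k) - (gradient f (prx (z k)) - gradient f (prx zbar))).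
  rewrite {1}(zE (z k)) {1}(zE zbar) limit_Fnor.
  move: (prx (z k)) (prx zbar) (F (z k)) => x y g.
  by apply/colP => i; rewrite !mxE; ring.
apply: (le_lt_trans (enormD _ _)); rewrite enormZ ger0_norm //.
have h1 := enormD (F (z k))
  (- (gradient f (prx (z k)) - gradient f (prx zbar))).
rewrite enormN in h1.
have h2 := grad_lipschitz _ _ (dom (z k)) (dom zbar).
have h3 := N1P _ N1k; have h4 := N2P _ N2k.
rewrite ltr_pdivlMr // in h3; rewrite ltr_pdivlMr // in h4.
have h5 := ler_wpM2l lam0 (le_trans h1 (lerD (lexx _) h2)).
move: h3 h4 h5; rewrite /Defs.chi.
move: (enorm (prx (z k) - prx zbar)) (enorm (F (z k))) (lam * enorm _) => v x y.
by move=> h3 h4 h5; apply: (le_lt_trans (lerD (lexx v) h5)); lra.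
Qed.

Lemma limit_crit : crit f phi (prx zbar).
Proof. by rewrite /crit /= -limit_Fnor; exact: Fnor_in_subdiff_psi. Qed.

End KurdykaLojasiewicz.

End Sequence.

End Algorithm.
End NormalMap.

(** * Convergence *)

Theorem theorem3p7 (R : realType) (n : nat)
  (f : 'cV[R]_n -> R) (phi : 'cV[R]_n -> \bar R) (lam L : R) (P : params R)
  (B : nat -> 'M[R]_n) (eps : nat -> R) (z : nat -> 'cV[R]_n)
  (zbar : 'cV[R]_n)
  (f_C1 : continuously_differentiable f)
  (phi_convex : econvex phi)
  (phi_lsc : lower_semicontinuous phi)
  (phi_proper : eproper phi)
  (L_ge0 : 0 <= L)
  (grad_lipschitz : forall x y, edom phi x -> edom phi y ->
     enorm (gradient f x - gradient f y) <= L * enorm (x - y))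
  (psi_bounded_below : exists m : R, forall x, dom_subdiff phi x ->
     (m%:E <= psi f phi x)%E)
  (lam_gt0 : 0 < lam)
  (P_admissible : admissible P)
  (eps_ge0 : forall k, 0 <= eps k)
  (z_generated : algorithm_sequence f phi lam P B eps z)
  (zbar_accumulation : cluster (z @ \oo) zbar)
  (KL_xbar : KL_property f phi (prox lam phi zbar)) :
  let x k := prox lam phi (z k) in
  [/\ (\sum_(0 <= k <oo) (enorm (x k.+1 - x k))%:E < +oo)%E,
      z @ \oo --> zbar
    & crit f phi (prox lam phi zbar)].
Proof.
move=> x; have [f_diff _] := f_C1.
have phi_subdiff : dom_subdiff phi !=set0.
  by exists (prox lam phi zbar); case: KL_xbar.
have zbar_near := cluster_enormP z zbar zbar_accumulation.
have [tau [tau0 step]] := z_generated.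
have [[K FK]|running] := pselect (exists K, Fnor f phi lam (z K) == 0).
  have z_const d : z (d + K)%N = z K.
    elim: d => [|d IH]; first by rewrite add0n.
    by have := step (d + K)%N; rewrite IH FK addSn.
  have zbarE : zbar = z K.
    apply/eqP; rewrite eq_sym -subr_eq0 -enorm_eq0.
    rewrite eq_le enorm_ge0 andbT leNgt; apply/negP => dist0.
    have [k Kk] := zbar_near _ K dist0.
    by rewrite -(subnK Kk) z_const ltxx.
  split.
  - apply: (nneseries_lt_pinfty _ K 0) => [k|k Kk]; first exact: enorm_ge0.
    rewrite big_nat_cond big1 // => i /andP[/andP[Ki _] _].
    by rewrite /x -(subnK Ki) -addSn !z_const subrr enorm0.
  - apply/cvg_enormP => r r0; exists K => k Kk.
    by rewrite -(subnK Kk) z_const zbarE subrr enorm0.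
  - have := Fnor_in_subdiff_psi f phi lam phi_convex phi_lsc phi_proper lam_gt0
      phi_subdiff (z K).
    by rewrite (eqP FK) zbarE.
have Fz k : Fnor f phi lam (z k) != 0.
  by apply/negP => /eqP Fk0; apply: running; exists k; rewrite Fk0.
have steps k : iteration f phi lam P k (B k) (eps k) (tau k) (z k) (tau k.+1)
    (z k.+1).
  by have := step k; rewrite (negPf (Fz k)) => -[].
split.
- exact: (prox_path_finite f phi lam L f_diff phi_convex phi_lsc
    phi_proper L_ge0 grad_lipschitz lam_gt0 phi_subdiff P P_admissible B eps z tau
    zbar tau0 Fz steps zbar_near KL_xbar).
- apply/cvg_enormP => r.
  exact: (iterates_cvg f phi lam L f_diff phi_convex phi_lsc
    phi_proper L_ge0 grad_lipschitz lam_gt0 phi_subdiff P P_admissible B eps z tau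
    zbar tau0 Fz steps zbar_near KL_xbar).
- exact: (limit_crit f phi lam L f_diff phi_convex phi_lsc
    phi_proper L_ge0 grad_lipschitz lam_gt0 phi_subdiff P P_admissible B eps z tau
    zbar tau0 steps zbar_near).
Qed.
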